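(* Let the data $(\sigma_i,b_i,h_i,\mathbb{S}_i)_{1\le i\le I}$, $h_0$, $(\chi_i,\mathcal{T}_i)_{1\le i\le I}$ and the constants $\lambda,R,K>0$ be as in the context, and suppose that assumptions (S), (E) and (R) of the context hold. Let $v\in \mathcal{C}(\mathcal{N}_R\times[0,K])$ be a continuous viscosity sub solution and $u\in \mathcal{C}(\mathcal{N}_R\times[0,K])$ a continuous viscosity super solution of the system $$\begin{cases} \lambda w_i(x,l)+\sup_{\beta_i\in\mathcal{B}_i}\big\{-\sigma_i(x,l,\beta_i)\partial_x^2w_i(x,l)+b_i(x,l,\beta_i)\partial_xw_i(x,l)+h_i(x,l,\beta_i)\big\}=0, & (x,l)\in(0,R)\times(0,K),\ 1\le i\le I,\\ \partial_lw(0,l)+\inf_{\vartheta\in\mathcal{O}}\big\{\sum_{i=1}^I\mathbb{S}_i(l,\vartheta)\partial_xw_i(0,l)+h_0(l,\vartheta)\big\}=0, & l\in(0,K),\\ w_i(R,l)=\chi_i(l), & l\in[0,K],\ 1\le i\le I,\\ w_i(x,K)=\mathcal{T}_i(x), & x\in[0,R],\ 1\le i\le I,\\ w_i(0,l)=w_j(0,l), & l\in[0,K],\ 1\le i,j\le I, \end{cases}$$ in the sense defined in the context, satisfying the boundary conditions $$\forall i\in\{1,\dots,I\},\ \forall l\in[0,K],\quad u_i(R,l)\ge v_i(R,l),$$ $$\forall i\in\{1,\dots,I\},\ \forall x\in[0,R],\quad u_i(x,K)\ge v_i(x,K).$$ Then $$\forall (x,i,l)\in[0,R]\times\{1,\dots,I\}\times[0,K],\quad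 u_i(x,l)\ge v_i(x,l).$$
   Context: **Network.** Fix $I\in\mathbb{N}$, $I\ge1$, and real numbers $R>0$, $K>0$, $\lambda>0$. The star-shaped network $\mathcal{N}_R=\bigcup_{i=1}^I\mathcal{R}_i$ is the union of $I$ rays $\mathcal{R}_i\cong[0,R]$ glued at their common endpoint $0$ (the junction point, or vertex, $\mathbf{0}$), distinct rays meeting only at $\mathbf{0}$. Points are written $(x,i)$ with $x\in[0,R]$, $i\in\{1,\dots,I\}$, and $(0,i)=(0,j)=\mathbf{0}$ for all $i,j$. $\mathcal{N}_R$ carries the geodesic metric, so a neighborhood of $\mathbf{0}$ contains a piece of every ray. **Function spaces.** $\mathcal{C}(\mathcal{N}_R\times[0,K])$ is the set of functions $f:((x,i),l)\mapsto f_i(x,l)\in\mathbb{R}$ such that every $f_i$ is continuous on $[0,R]\times[0,K]$ and $f_i(0,l)=f_j(0,l)=:f(0,l)$ for all $i,j,l$. The test function space $\mathcal{C}^{2,0}_{\mathbf{0},1}(\mathcal{N}_R\times[0,K])$ is the set of functions $f:((x,i),l)\mapsto f_i(x,l)\in\mathbb{R}$ such that every $f_i$ belongs to $\mathcal{C}^{2,0}([0,R]\times[0,K])$ (functions of class $C^2$ with respect to the first variable and continuous with respect to the second, i.e. $f_i,\partial_xf_i,\partial_x^2f_i$ are continuous on $[0,R]\times[0,K]$), $f_i(0,l)=f_j(0,l)=:f(0,l)$ for all $i,j,l$, and $l\mapsto f(0,l)$ belongs to $\mathcal{C}^1([0,K])$. **Data.** $\mathcal{B}_1,\dots,\mathcal{B}_I$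 are nonempty compact subsets of $\mathbb{R}$ and $\mathcal{O}$ is a nonempty compact subset of $\mathbb{R}^I$. For each $i$, $\sigma_i,b_i,h_i:[0,R]\times[0,K]\times\mathcal{B}_i\to\mathbb{R}$, $\mathbb{S}_i:[0,K]\times\mathcal{O}\to\mathbb{R}$, $\chi_i:[0,K]\to\mathbb{R}$, $\mathcal{T}_i:[0,R]\to\mathbb{R}$ and $h_0:[0,K]\times\mathcal{O}\to\mathbb{R}$ are continuous. **Assumptions.** (S) There is $\underline{\zeta}>0$ with $\mathbb{S}_i(l,\vartheta)\ge\underline{\zeta}$ for all $i$ and all $(l,\vartheta)\in[0,K]\times\mathcal{O}$. (E) There is $\underline{\sigma}>0$ with $\sigma_i(x,l,\beta_i)\ge\underline{\sigma}$ for all $i$ and all $(x,l,\beta_i)\in[0,R]\times[0,K]\times\mathcal{B}_i$. (R) There are constants $|b|,|h|,\overline{\zeta},\overline{\sigma}\in(0,+\infty)$ such that, for every $i$: for each of the pairs $(F,C)=(b_i,|b|)$, $(\sigma_i,\overline{\sigma})$, $(h_i,|h|)$, $$\sup_{x,l,\beta_i}|F(x,l,\beta_i)|+\sup_{l,\beta_i}\sup_{x\ne y}\frac{|F(x,l,\beta_i)-F(y,l,\beta_i)|}{|x-y|}+\sup_{x,\beta_i}\sup_{l\ne l'}\frac{|F(x,l,\beta_i)-F(x,l',\beta_i)|}{|l-l'|}\le C,$$ and for each of the pairs $(G,C)=(\mathbb{S}_i,\overline{\zeta})$, $(h_0,|h|)$, $$\sup_{l,\vartheta}|G(l,\vartheta)|+\sup_{\vartheta}\sup_{l\ne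 l'}\frac{|G(l,\vartheta)-G(l',\vartheta)|}{|l-l'|}\le C.$$ **Viscosity super/sub solutions.** A function $u\in\mathcal{C}(\mathcal{N}_R\times[0,K])$ is a continuous viscosity super solution of the system if for every $\phi\in\mathcal{C}^{2,0}_{\mathbf{0},1}(\mathcal{N}_R\times[0,K])$ and every local minimum point $(x_\star,i_\star,l_\star)\in[0,R]\times\{1,\dots,I\}\times[0,K]$ of $u-\phi$ with $(u-\phi)_{i_\star}(x_\star,l_\star)=0$: - if $(x_\star,l_\star)\in(0,R)\times(0,K)$, then $\lambda\phi_{i_\star}(x_\star,l_\star)+\sup_{\beta\in\mathcal{B}_{i_\star}}\{-\sigma_{i_\star}(x_\star,l_\star,\beta)\partial_x^2\phi_{i_\star}(x_\star,l_\star)+b_{i_\star}(x_\star,l_\star,\beta)\partial_x\phi_{i_\star}(x_\star,l_\star)+h_{i_\star}(x_\star,l_\star,\beta)\}\ge0$; - if $x_\star=0$ and $l_\star\in(0,K)$, then $\partial_l\phi(0,l_\star)+\inf_{\vartheta\in\mathcal{O}}\{\sum_{i=1}^I\mathbb{S}_i(l_\star,\vartheta)\partial_x\phi_i(0,l_\star)+h_0(l_\star,\vartheta)\}\le0$. A function $v\in\mathcal{C}(\mathcal{N}_R\times[0,K])$ is a continuous viscosity sub solution if for every such $\phi$ and every local maximum point $(x_\star,i_\star,l_\star)$ of $v-\phi$ with $(v-\phi)_{i_\star}(x_\star,l_\star)=0$, the same two conditions hold with the inequalities reversed ($\le0$ in the first, $\ge0$ in the second). Local extrema are taken in $\mathcal{N}_R\times[0,K]$.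 The conditions at $x=R$ and $l=K$ in the system are not part of the definition of super/sub solution. *)

(* Defs.v *)
From mathcomp Require Import all_boot all_order all_algebra.
From mathcomp Require Import all_classical all_reals all_analysis.
Set Implicit Arguments.
Unset Strict Implicit.
Unset Printing Implicit Defensive.
Import Order.TTheory GRing.Theory Num.Theory.
Import numFieldNormedType.Exports.
Local Open Scope classical_set_scope.
Local Open Scope ring_scope.

(** A function on the network is a family [f i x l] indexed by the rays
    [i : 'I_n], subject to compatibility at [x = 0].  Functions are total on the
    ambient spaces, but every notion below only depends on their values for
    [x] in [0, ray_length], [l] in [0, horizon] and controls in the control sets. *)

(** The data of the system, with [A = ray_ctrl i] and [O = vertex_ctrl],
<<
  discount * w i x l + sup_(b in A) (- sigma i x l b * (d/dx)^2 w i x l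
    + drift i x l b * d/dx w i x l + cost i x l b) = 0
  d/dl w 0 l + inf_(t in O) (\sum_i spin i l t * d/dx w i 0 l
    + vertex_cost l t) = 0
  w i ray_length l = boundary_data i l,  w i x horizon = terminal_data i x
>>
    where the two equations hold for [0 < x < ray_length] and
    [0 < l < horizon].  The last line is not part of the notion of sub and
    super solution. *)
Record system (R : realType) (n : nat) := System {
  ray_length : R;
  horizon : R;
  discount : R;
  ray_ctrl : 'I_n -> set R;
  vertex_ctrl : set 'rV[R]_n;
  sigma : 'I_n -> R -> R -> R -> R;
  drift : 'I_n -> R -> R -> R -> R;
  cost : 'I_n -> R -> R -> R -> R;
  spin : 'I_n -> R -> 'rV[R]_n -> R;
  vertex_cost : R -> 'rV[R]_n -> R;
  boundary_data : 'I_n -> R -> R;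
  terminal_data : 'I_n -> R -> R
}.

Section Derivatives.
Context {R : realType}.
Implicit Types (A : set R) (f : R -> R).

(** Derivatives relative to a set: one-sided at the ends of an interval. *)

Definition diff_quot f (x : R) : R -> R := fun y => (f y - f x) / (y - x).

Definition derivable_in A f (x : R) : Prop := cvg (diff_quot f x @ within A x^').

Definition derive_in A f (x : R) : R := lim (diff_quot f x @ within A x^').

Definition C1_on A f : Prop :=
  [/\ {within A, continuous f},
      forall x, A x -> derivable_in A f x
    & {within A, continuous (derive_in A f)}].

End Derivatives.

Section Network.
Context {R : realType} {n : nat} (D : system R n).

Definition xset : set R := `[0, ray_length D].
Definition lset : set R := `[0, horizon D].

Definition dx (f : R -> R -> R) (x l : R) : R := derive_in xset (f^~ l) x.
Definition dxx (f : R -> R -> R) : R -> R -> R := dx (dx f).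
Definition dl (f : R -> R -> R) (x l : R) : R := derive_in lset (f x) l.

Definition cont_xl (f : R -> R -> R) : Prop :=
  {within xset `*` lset, continuous (fun p : R * R => f p.1 p.2)}.

Definition C20 (f : R -> R -> R) : Prop :=
  [/\ cont_xl f,
      forall x l, xset x -> lset l -> derivable_in xset (f^~ l) x,
      cont_xl (dx f),
      forall x l, xset x -> lset l -> derivable_in xset ((dx f)^~ l) x
    & cont_xl (dxx f)].

Definition glued (f : 'I_n -> R -> R -> R) : Prop :=
  forall i j l, lset l -> f i 0 l = f j 0 l.

Definition network_continuous (f : 'I_n -> R -> R -> R) : Prop :=
  (forall i, cont_xl (f i)) /\ glued f.

Definition test_function (f : 'I_n -> R -> R -> R) : Prop :=
  [/\ forall i, C20 (f i), glued f & forall i, C1_on lset (f i 0)].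

(** Geodesic distance between [(x, i)] and [(y, j)], for [x, y >= 0]. *)
Definition geodist (x : R) (i : 'I_n) (y : R) (j : 'I_n) : R :=
  if i == j then `|x - y| else x + y.

Definition local_min (g : 'I_n -> R -> R -> R) (x : R) (i : 'I_n) (l : R) :=
  exists2 e : R, 0 < e & forall y j m, xset y -> lset m ->
    geodist x i y j < e -> `|l - m| < e -> g i x l <= g j y m.

Definition local_max (g : 'I_n -> R -> R -> R) (x : R) (i : 'I_n) (l : R) :=
  exists2 e : R, 0 < e & forall y j m, xset y -> lset m ->
    geodist x i y j < e -> `|l - m| < e -> g j y m <= g i x l.

(** The two left-hand sides of the system, for a smooth function [f].  The real
    [sup] and [inf] are genuine: the control sets are nonempty and compact, and
    the coefficients are continuous. *)
Definition ray_operator (f : 'I_n -> R -> R -> R) (i : 'I_n) (x l : R) : R :=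
  discount D * f i x l +
  sup [set - sigma D i x l beta * dxx (f i) x l
           + drift D i x l beta * dx (f i) x l
           + cost D i x l beta | beta in ray_ctrl D i].

(** [dl (f i) 0 l] does not depend on the ray [i] when [f] is [glued]. *)
Definition vertex_operator (f : 'I_n -> R -> R -> R) (i : 'I_n) (l : R) : R :=
  dl (f i) 0 l +
  inf [set \sum_(j < n) spin D j l theta * dx (f j) 0 l
           + vertex_cost D l theta | theta in vertex_ctrl D].

Definition supersolution (u : 'I_n -> R -> R -> R) : Prop :=
  network_continuous u /\
  forall phi, test_function phi ->
  forall x i l, xset x -> lset l ->
    local_min (fun j y m => u j y m - phi j y m) x i l ->
    u i x l - phi i x l = 0 ->
    (0 < x < ray_length D -> 0 < l < horizon D -> 0 <= ray_operator phi i x l) /\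
    (x = 0 -> 0 < l < horizon D -> vertex_operator phi i l <= 0).

Definition subsolution (v : 'I_n -> R -> R -> R) : Prop :=
  network_continuous v /\
  forall phi, test_function phi ->
  forall x i l, xset x -> lset l ->
    local_max (fun j y m => v j y m - phi j y m) x i l ->
    v i x l - phi i x l = 0 ->
    (0 < x < ray_length D -> 0 < l < horizon D -> ray_operator phi i x l <= 0) /\
    (x = 0 -> 0 < l < horizon D -> 0 <= vertex_operator phi i l).

Definition cont_ray (i : 'I_n) (F : R -> R -> R -> R) : Prop :=
  {within xset `*` lset `*` ray_ctrl D i,
    continuous (fun p : R * R * R => F p.1.1 p.1.2 p.2)}.

Definition cont_vertex (G : R -> 'rV[R]_n -> R) : Prop :=
  {within lset `*` vertex_ctrl D,
    continuous (fun p : R * 'rV[R]_n => G p.1 p.2)}.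

Record continuous_data : Prop := ContinuousData {
  ray_length_gt0 : 0 < ray_length D;
  horizon_gt0 : 0 < horizon D;
  discount_gt0 : 0 < discount D;
  ray_ctrl_neq0 : forall i, ray_ctrl D i !=set0;
  ray_ctrl_compact : forall i, compact (ray_ctrl D i);
  vertex_ctrl_neq0 : vertex_ctrl D !=set0;
  vertex_ctrl_compact : compact (vertex_ctrl D);
  sigma_cont : forall i, cont_ray i (sigma D i);
  drift_cont : forall i, cont_ray i (drift D i);
  cost_cont : forall i, cont_ray i (cost D i);
  spin_cont : forall i, cont_vertex (spin D i);
  vertex_cost_cont : cont_vertex (vertex_cost D);
  boundary_data_cont : forall i, {within lset, continuous (boundary_data D i)};
  terminal_data_cont : forall i, {within xset, continuous (terminal_data D i)}
}.

Definition spin_bounded_below : Prop :=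
  exists2 z : R, 0 < z &
    forall i l theta, lset l -> vertex_ctrl D theta -> z <= spin D i l theta.

Definition elliptic : Prop :=
  exists2 s : R, 0 < s &
    forall i x l beta, xset x -> lset l -> ray_ctrl D i beta ->
      s <= sigma D i x l beta.

(** The suprema below are not known to be finite beforehand, so they are taken
    in the extended reals (the real [sup] is 0 on unbounded sets). *)
Definition lip_const (A : set R) (f : R -> R) : \bar R :=
  ereal_sup [set (`|f p.1 - f p.2| / `|p.1 - p.2|)%:E
    | p in [set p : R * R | [/\ A p.1, A p.2 & p.1 != p.2]]].

Definition ray_norm (i : 'I_n) (F : R -> R -> R -> R) : \bar R :=
  (ereal_sup [set `|F p.1.1 p.1.2 p.2|%:E
     | p in xset `*` lset `*` ray_ctrl D i]
   + ereal_sup [set lip_const xset (fun x => F x p.1 p.2)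
     | p in lset `*` ray_ctrl D i]
   + ereal_sup [set lip_const lset (fun l => F p.1 l p.2)
     | p in xset `*` ray_ctrl D i])%E.

Definition vertex_norm (G : R -> 'rV[R]_n -> R) : \bar R :=
  (ereal_sup [set `|G p.1 p.2|%:E | p in lset `*` vertex_ctrl D]
   + ereal_sup [set lip_const lset (fun l => G l theta)
     | theta in vertex_ctrl D])%E.

Definition lipschitz_data : Prop :=
  exists cb ch cz cs : R,
    [/\ [/\ 0 < cb, 0 < ch, 0 < cz & 0 < cs],
        forall i, [/\ (ray_norm i (drift D i) <= cb%:E)%E,
                      (ray_norm i (sigma D i) <= cs%:E)%E
                    & (ray_norm i (cost D i) <= ch%:E)%E],
        forall i, (vertex_norm (spin D i) <= cz%:E)%E
      & (vertex_norm (vertex_cost D) <= ch%:E)%E].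

End Network.

(* Main.v *)
Require Import Defs.
From mathcomp Require Import all_boot all_order all_algebra.
From mathcomp Require Import all_classical all_reals all_analysis.
From mathcomp Require Import ring lra.
Import Order.TTheory GRing.Theory Num.Theory.
Import numFieldNormedType.Exports.
Local Open Scope classical_set_scope.
Local Open Scope ring_scope.

(** On a ray no derivative in [l] occurs, so sub and super solutions are one
    dimensional viscosity solutions on every slice [l = const], and since the
    equation is uniformly elliptic with Lipschitz coefficients, on a short
    interval it is solved up to an arbitrarily small error by a quadratic
    polynomial [Z] with prescribed end values.  Hence, if [v - u] attains its
    positive maximum [M] over a ray inside the ray, take [Z = v] at the ends of
    a short interval around the maximum: [Z] is a strict super solution and
    [Z - M] a strict sub solution, so [v <= Z] and [Z - M < u], which is absurd.
    Therefore a positive maximum is only attained at the vertex.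

    If [w = v - u > 0] at the vertex at time [l0], the same construction on a
    short interval [[0, d_i]] of every ray, with [Z_i = v] at the vertex,
    separates [v] from [u]: [v <= Z_i] and [Z_i - w <= u], with equality at the
    vertex.  The functions [Z_i], shifted by functions of [l], are thus
    admissible in the vertex condition for both [v] and [u], and they have the
    same slopes: the two Kirchhoff terms cancel and [w] cannot decrease faster
    than at any prescribed small rate after [l0].  This contradicts [w <= 0] at
    the horizon. *)

Set Implicit Arguments.
Unset Strict Implicit.
Unset Printing Implicit Defensive.

(** * The Hamiltonians *)

Section Hamiltonians.
Context {R : realType}.

(** The common bound [c] keeps both real suprema genuine: on an unbounded set [sup] is the default 0
    and the estimate could fail. *)
Lemma dist_sup_image (T : Type) (A : set T) (f g : T -> R) (c e : R) :
  A !=set0 -> (forall t, A t -> f t <= c) -> (forall t, A t -> g t <= c) ->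
  (forall t, A t -> `|f t - g t| <= e) ->
  `|sup [set f t | t in A] - sup [set g t | t in A]| <= e.
Proof.
move=> A0 fc gc fge.
have half (f1 g1 : T -> R) : (forall t, A t -> g1 t <= c) ->
    (forall t, A t -> `|f1 t - g1 t| <= e) ->
    sup [set f1 t | t in A] <= sup [set g1 t | t in A] + e.
  move=> g1c fg1; apply: ge_sup; first exact: image_nonempty.
  move=> _ [t At <-].
  have : g1 t <= sup [set g1 t | t in A].
    by apply: ub_le_sup; [exists c => _ [s As <-]; exact: g1c|exists t].
  by have := fg1 t At; rewrite ler_norml => /andP[_]; lra.
have h1 := half f g gc fge.
have h2 : sup [set g t | t in A] <= sup [set f t | t in A] + e.
  by apply: half => // t At; rewrite distrC; exact: fge.
by rewrite ler_norml; apply/andP; split; lra.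
Qed.

Lemma dist_inf_image (T : Type) (A : set T) (f g : T -> R) (c e : R) :
  A !=set0 -> (forall t, A t -> c <= f t) -> (forall t, A t -> c <= g t) ->
  (forall t, A t -> `|f t - g t| <= e) ->
  `|inf [set f t | t in A] - inf [set g t | t in A]| <= e.
Proof.
move=> A0 fc gc fge; rewrite /inf !image_comp -opprD normrN.
apply: (@dist_sup_image _ _ (-%R \o f) (-%R \o g) (- c)) => //= t At.
- by rewrite lerN2 fc.
- by rewrite lerN2 gc.
- by rewrite -opprD normrN fge.
Qed.

Context {n : nat} (D : system R n).

(** The ray equation with the value and the two space derivatives replaced by free variables [r],
    [p], [q]. *)
Definition ham (i : 'I_n) (x l r p q : R) : R := discount D * r +
  sup [set - sigma D i x l beta * q + drift D i x l beta * p
           + cost D i x l beta | beta in ray_ctrl D i].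

Definition vertex_ham (l : R) (s : 'I_n -> R) : R :=
  inf [set \sum_(j < n) spin D j l theta * s j + vertex_cost D l theta
      | theta in vertex_ctrl D].

Let X := ray_length D.
Let K := horizon D.

(** * Real Lipschitz bounds extracted from the extended norms *)

Definition lip_ray i (F : R -> R -> R -> R) c :=
  forall x y l m beta, 0 <= x <= X -> 0 <= y <= X -> 0 <= l <= K ->
    0 <= m <= K -> ray_ctrl D i beta ->
  `|F x l beta| <= c /\ `|F x l beta - F y m beta| <= c * (`|x - y| + `|l - m|).

Definition lip_vertex (G : R -> 'rV[R]_n -> R) c :=
  forall l m theta, 0 <= l <= K -> 0 <= m <= K -> vertex_ctrl D theta ->
  `|G l theta| <= c /\ `|G l theta - G m theta| <= c * `|l - m|.

Lemma ereal_sup_image_le (T : Type) (A : set T) (f : T -> \bar R) (M : \bar R) t :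
  (ereal_sup [set f t | t in A] <= M)%E -> A t -> (f t <= M)%E.
Proof.
by move=> fM At; apply: le_trans fM; apply: ereal_sup_ubound; exists t.
Qed.

Lemma ereal_sup_image_ge0 (T : Type) (A : set T) (f : T -> \bar R) t :
  A t -> (0 <= f t)%E -> (0 <= ereal_sup [set f t | t in A])%E.
Proof.
by move=> At ft; apply: le_trans ft _; apply: ereal_sup_ubound; exists t.
Qed.

Lemma lip_const_ge0 (A : set R) (f : R -> R) x y : A x -> A y -> x != y ->
  (0 <= lip_const A f)%E.
Proof.
move=> Ax Ay xy; apply: (@ereal_sup_image_ge0 _ _ _ (x, y)) => //=; rewrite lee_fin divr_ge0.
Qed.

Lemma lip_const_le (A : set R) (f : R -> R) c x y : 0 <= c ->
  (lip_const A f <= c%:E)%E -> A x -> A y -> `|f x - f y| <= c * `|x - y|.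
Proof.
move=> c0 Ac Ax Ay; have [->|xy] := eqVneq x y.
  by rewrite !subrr normr0 mulr0.
have /(_ (x, y) (And3 Ax Ay xy)) := ereal_sup_image_le Ac.
by rewrite /= lee_fin ler_pdivrMr ?normr_gt0 ?subr_eq0.
Qed.

(** The norm is a sum of three suprema, so each is at most [c] once the other two are nonnegative.
    This requires nonempty index sets, an empty supremum being minus infinity: a control and the two
    distinct ends of each interval provide the indices. *)
Lemma lip_ray_norm i F c : 0 < X -> 0 < K -> ray_ctrl D i !=set0 ->
  (ray_norm D i F <= c%:E)%E -> lip_ray i F c.
Proof.
move=> X0 K0 [b0 Bb0]; rewrite /ray_norm.
have x0 : xset D 0 by rewrite /xset /= in_itv/= lexx ltW.
have l0 : lset D 0 by rewrite /lset /= in_itv/= lexx ltW.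
have xX : xset D X by rewrite /xset /= in_itv/= lexx ltW.
have lK : lset D K by rewrite /lset /= in_itv/= lexx ltW.
set s1 := ereal_sup _; set s2 := ereal_sup _; set s3 := ereal_sup _ => sc.
have s1ge0 : (0 <= s1)%E.
  apply: (@ereal_sup_image_ge0 _ _ _ (0, 0, b0)) => //=.
have s2ge0 : (0 <= s2)%E.
  apply: (@ereal_sup_image_ge0 _ _ _ (0, b0)) => //=.
  by apply: (@lip_const_ge0 _ _ 0 X) => //; rewrite lt_eqF.
have s3ge0 : (0 <= s3)%E.
  apply: (@ereal_sup_image_ge0 _ _ _ (0, b0)) => //=.
  by apply: (@lip_const_ge0 _ _ 0 K) => //; rewrite lt_eqF.
have s1c : (s1 <= c%:E)%E.
  by apply: le_trans sc; rewrite -addeA leeDl// adde_ge0.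
have s2c : (s2 <= c%:E)%E.
  by apply: le_trans sc; rewrite (addeC s1) -addeA leeDl// adde_ge0.
have s3c : (s3 <= c%:E)%E.
  by apply: le_trans sc; rewrite leeDr// adde_ge0.
have c0 : 0 <= c by rewrite -lee_fin (le_trans s1ge0).
move=> x y l m b hx hy hl hm Bb.
have hx' : xset D x by rewrite /xset /= in_itv.
have hy' : xset D y by rewrite /xset /= in_itv.
have hl' : lset D l by rewrite /lset /= in_itv.
have hm' : lset D m by rewrite /lset /= in_itv.
split.
  by have /(_ (x, l, b)) := ereal_sup_image_le s1c; rewrite lee_fin; exact.
have h2 : `|F x l b - F y l b| <= c * `|x - y|.
  have /(_ (l, b)) := ereal_sup_image_le s2c => /(_ (conj hl' Bb)) /= H.
  exact: (lip_const_le c0 H).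
have h3 : `|F y l b - F y m b| <= c * `|l - m|.
  have /(_ (y, b)) := ereal_sup_image_le s3c => /(_ (conj hy' Bb)) /= H.
  exact: (lip_const_le c0 H).
rewrite -(subrKA (F y l b)) mulrDr (le_trans (ler_normD _ _))//.
exact: lerD.
Qed.

Lemma lip_vertex_norm G c : 0 < K -> vertex_ctrl D !=set0 ->
  (vertex_norm D G <= c%:E)%E -> lip_vertex G c.
Proof.
move=> K0 [t0 Bt0]; rewrite /vertex_norm.
have l0 : lset D 0 by rewrite /lset /= in_itv/= lexx ltW.
have lK : lset D K by rewrite /lset /= in_itv/= lexx ltW.
set s1 := ereal_sup _; set s2 := ereal_sup _ => sc.
have s1ge0 : (0 <= s1)%E.
  apply: (@ereal_sup_image_ge0 _ _ _ (0, t0)) => //=.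
have s2ge0 : (0 <= s2)%E.
  apply: (@ereal_sup_image_ge0 _ _ _ t0) => //=.
  by apply: (@lip_const_ge0 _ _ 0 K) => //; rewrite lt_eqF.
have s1c : (s1 <= c%:E)%E by apply: le_trans sc; rewrite leeDl.
have s2c : (s2 <= c%:E)%E by apply: le_trans sc; rewrite leeDr.
have c0 : 0 <= c by rewrite -lee_fin (le_trans s1ge0).
move=> l m t hl hm Bt.
have hl' : lset D l by rewrite /lset /= in_itv.
have hm' : lset D m by rewrite /lset /= in_itv.
split.
  by have /(_ (l, t)) := ereal_sup_image_le s1c; rewrite lee_fin; exact.
have /(_ t Bt) H := ereal_sup_image_le s2c.
exact: (lip_const_le c0 H).
Qed.


(** The coefficients multiply [p] and [q], so a displacement in [x] and [l] carries the weight 1 +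
    |p| + |q|, with the arguments of one side only. *)
Definition ham_lipschitz (C : R) (H : R -> R -> R -> R -> R -> R) :=
  forall x y l m r s p p' q q', 0 <= x <= X -> 0 <= y <= X -> 0 <= l <= K ->
    0 <= m <= K ->
  `|H x l r p q - H y m s p' q'| <= C *
     ((`|x - y| + `|l - m|) * (1 + `|p| + `|q|) + `|r - s| + `|p - p'| + `|q - q'|).

Definition ham_discounted (H : R -> R -> R -> R -> R -> R) :=
  forall x l r s p q, H x l r p q - H x l s p q = discount D * (r - s).

Lemma ham_discountedP i : ham_discounted (ham i).
Proof. by move=> x l r s p q; rewrite /ham; ring. Qed.

Lemma normM_le (a b c : R) : `|a| <= c -> `|a * b| <= c * `|b|.
Proof. by move=> ac; rewrite normrM ler_wpM2r. Qed.

Lemma integrand_bound c x l p q i beta cs cb ch :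
  c = cs + cb + ch -> 0 <= cs -> 0 <= cb -> 0 <= ch ->
  `|sigma D i x l beta| <= cs ->
  `|drift D i x l beta| <= cb -> `|cost D i x l beta| <= ch ->
  `|- sigma D i x l beta * q + drift D i x l beta * p + cost D i x l beta|
    <= c * (1 + `|p| + `|q|).
Proof.
move=> -> cs0 cb0 ch0 hs hb hh.
have h1 : `|- sigma D i x l beta * q| <= cs * `|q|.
  by apply: normM_le; rewrite normrN.
have h2 := normM_le p hb.
rewrite (le_trans (ler_normD _ _))//.
apply: le_trans (lerD (ler_normD _ _) hh) _.
apply: le_trans (lerD (lerD h1 h2) (lexx _)) _.
(* The difference of the two sides is an explicit sum of products of nonnegative factors. *)
rewrite -subr_ge0; set S := (X in 0 <= X).
have -> : S = cs * (1 + `|p|) + cb * (1 + `|q|) + ch * (`|p| + `|q|) by rewrite /S; ring.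
by rewrite !addr_ge0 // mulr_ge0 // addr_ge0.
Qed.

(** A supremum inherits a Lipschitz estimate that its integrands satisfy uniformly in the control.
    The bound at zero arguments is the starting point for solving [H = e] in [q]. *)
Lemma ham_lipschitz_data : continuous_data D -> lipschitz_data D ->
  exists2 C, 0 < C & forall i, ham_lipschitz C (ham i) /\
    (forall x l, 0 <= x <= X -> 0 <= l <= K -> `|ham i x l 0 0 0| <= C).
Proof.
move=> hD [cb [ch [cz [cs [[cb0 ch0 cz0 cs0] hray _ _]]]]].
have X0 := ray_length_gt0 hD; have K0 := horizon_gt0 hD.
have d0 := discount_gt0 hD.
pose c := cs + cb + ch.
have c0 : 0 < c by rewrite /c; lra.
exists (c + discount D); first lra.
move=> i; have [hb hs hh] := hray i.
have B0 := ray_ctrl_neq0 hD i.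
have {}hb := lip_ray_norm X0 K0 B0 hb.
have {}hs := lip_ray_norm X0 K0 B0 hs.
have {}hh := lip_ray_norm X0 K0 B0 hh.
have bnd x l p q beta : 0 <= x <= X -> 0 <= l <= K -> ray_ctrl D i beta ->
    `|- sigma D i x l beta * q + drift D i x l beta * p + cost D i x l beta|
    <= c * (1 + `|p| + `|q|).
  move=> hx hl Bb.
  have [s1 _] := hs x x l l beta hx hx hl hl Bb.
  have [b1 _] := hb x x l l beta hx hx hl hl Bb.
  have [h1 _] := hh x x l l beta hx hx hl hl Bb.
  by apply: (@integrand_bound _ _ _ _ _ _ _ cs cb ch) => //; exact: ltW.
split; last first.
  move=> x l hx hl; rewrite /ham mulr0 add0r.
  have ub beta : ray_ctrl D i beta -> 
      `|- sigma D i x l beta * 0 + drift D i x l beta * 0 + cost D i x l beta| <= c.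
    by move=> Bb; have := bnd x l 0 0 beta hx hl Bb; rewrite normr0 !addr0 mulr1.
  have [b0 Bb0] := B0.
  rewrite ler_norml; apply/andP; split.
    have := ub _ Bb0; rewrite ler_norml => /andP[h _].
    have : - c <= sup [set - sigma D i x l beta * 0 + drift D i x l beta * 0
              + cost D i x l beta | beta in ray_ctrl D i].
      apply: le_trans h _; apply: ub_le_sup; last by exists b0.
      by exists c => _ [b Bb <-]; exact: le_trans (ler_norm _) (ub _ Bb).
    by lra.
  suff : sup [set - sigma D i x l beta * 0 + drift D i x l beta * 0
              + cost D i x l beta | beta in ray_ctrl D i] <= c by lra.
  apply: ge_sup; first exact: image_nonempty.
  by move=> _ [b Bb <-]; exact: le_trans (ler_norm _) (ub _ Bb).
move=> x y l m r s p p' q q' hx hy hl hm; rewrite /ham opprD addrACA -mulrBr.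
apply: le_trans (ler_normD _ _) _; rewrite normrM (gtr0_norm d0).
set N := `|x - y| + `|l - m|.
have N0 : 0 <= N by rewrite addr_ge0.
apply: (@le_trans _ _ (discount D * `|r - s| + c *
  (N * (1 + `|p| + `|q|) + `|p - p'| + `|q - q'|))).
  rewrite lerD2l; apply: (dist_sup_image (c := Num.max (c * (1 + `|p| + `|q|))
    (c * (1 + `|p'| + `|q'|)))) => // b Bb.
  - rewrite (le_trans (ler_norm _))// (le_trans (bnd _ _ _ _ _ hx hl Bb))//.
    by rewrite le_max lexx.
  - rewrite (le_trans (ler_norm _))// (le_trans (bnd _ _ _ _ _ hy hm Bb))//.
    by rewrite le_max lexx orbT.
  have [_ s1] := hs x y l m b hx hy hl hm Bb.
  have [s2 _] := hs y y m m b hy hy hm hm Bb.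
  have [_ b1] := hb x y l m b hx hy hl hm Bb.
  have [b2 _] := hb y y m m b hy hy hm hm Bb.
  have [_ h1] := hh x y l m b hx hy hl hm Bb.
  rewrite -/N in s1 b1 h1.
  set S1 := sigma D i x l b in s1 *; set S2 := sigma D i y m b in s1 s2 *.
  set T1 := drift D i x l b in b1 *; set T2 := drift D i y m b in b1 b2 *.
  set U1 := cost D i x l b in h1 *; set U2 := cost D i y m b in h1 *.
  (* Each product telescopes: the coefficient difference multiplies [q] or [p], a bounded
     coefficient multiplies [q - q'] or [p - p']. *)
  have -> : - S1 * q + T1 * p + U1 - (- S2 * q' + T2 * p' + U2) =
    (- ((S1 - S2) * q) - S2 * (q - q')) + ((T1 - T2) * p + T2 * (p - p'))
    + (U1 - U2) by ring.
  have g1 := normM_le q s1; have g2 := normM_le (q - q') s2.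
  have g3 := normM_le p b1; have g4 := normM_le (p - p') b2.
  apply: le_trans (ler_normD _ _) _.
  apply: le_trans (lerD (ler_normD _ _) h1) _.
  apply: le_trans (lerD (lerD (ler_normD _ _) (ler_normD _ _)) (lexx _)) _.
  rewrite !normrN.
  apply: le_trans (lerD (lerD (lerD g1 g2) (lerD g3 g4)) (lexx _)) _.
  rewrite -subr_ge0; set Z := (X in 0 <= X).
  have -> : Z = cs * (N * (1 + `|p|) + `|p - p'|) + cb * (N * (1 + `|q|) + `|q - q'|)
     + ch * (N * (`|p| + `|q|) + `|p - p'| + `|q - q'|) by rewrite /Z /c; ring.
  by rewrite !addr_ge0 // mulr_ge0 ?(ltW cs0) ?(ltW cb0) ?(ltW ch0) // !addr_ge0 // mulr_ge0 // addr_ge0.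
rewrite -subr_ge0; set Z := (X in 0 <= X).
have -> : Z = c * `|r - s| + discount D * (N * (1 + `|p| + `|q|) + `|p - p'| + `|q - q'|).
  by rewrite /Z; ring.
by rewrite !addr_ge0 // mulr_ge0 ?(ltW c0) ?(ltW d0) // !addr_ge0 // mulr_ge0 // !addr_ge0.
Qed.

Definition ham_elliptic s (H : R -> R -> R -> R -> R -> R) :=
  forall x l r p q q', 0 <= x <= X -> 0 <= l <= K -> q <= q' ->
  H x l r p q' <= H x l r p q - s * (q' - q).

(** Every integrand is affine in [q] with slope at most [- s]; the decrease is uniform in the
    control, hence passes to the supremum. *)
Lemma ham_ellipticP : continuous_data D -> lipschitz_data D -> elliptic D ->
  exists2 s, 0 < s & forall i, ham_elliptic s (ham i).
Proof.
move=> hD [cb [ch [cz [cs [[cb0 ch0 cz0 cs0] hray _ _]]]]] [s s0 hs].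
exists s => // i x l r p q q' hx hl qq'; rewrite /ham.
have X0 := ray_length_gt0 hD; have K0 := horizon_gt0 hD.
have B0 := ray_ctrl_neq0 hD i.
have [hb hsg hh] := hray i.
have {}hb := lip_ray_norm X0 K0 B0 hb.
have {}hsg := lip_ray_norm X0 K0 B0 hsg.
have {}hh := lip_ray_norm X0 K0 B0 hh.
rewrite -addrA lerD2l; apply: ge_sup; first exact: image_nonempty.
move=> _ [b Bb <-].
set A := [set _ | _ in _].
have : - sigma D i x l b * q + drift D i x l b * p + cost D i x l b <= sup A.
  apply: ub_le_sup; last by exists b.
  exists ((cs + cb + ch) * (1 + `|p| + `|q|)) => _ [t Bt <-].
  apply: le_trans (ler_norm _) _.
  have [s1 _] := hsg x x l l t hx hx hl hl Bt.
  have [b1 _] := hb x x l l t hx hx hl hl Bt.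
  have [h1 _] := hh x x l l t hx hx hl hl Bt.
  by apply: (@integrand_bound _ _ _ _ _ _ _ cs cb ch) => //; exact: ltW.
have := hs i x l b; rewrite /xset /lset /= !in_itv /= => /(_ hx hl Bb) h1.
by nra.
Qed.

(** [C] may depend on the slopes: those of the separating quadratics stay fixed while [l] moves. *)
Lemma vertex_ham_lipschitz : continuous_data D -> lipschitz_data D ->
  forall s : 'I_n -> R, exists2 C, 0 < C & forall l m, 0 <= l <= K -> 0 <= m <= K ->
    `|vertex_ham l s - vertex_ham m s| <= C * `|l - m|.
Proof.
move=> hD [cb [ch [cz [cs [[cb0 ch0 cz0 cs0] _ hsp hvc]]]]] s.
have K0 := horizon_gt0 hD; have O0 := vertex_ctrl_neq0 hD.
have {}hsp j := lip_vertex_norm K0 O0 (hsp j).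
have {}hvc := lip_vertex_norm K0 O0 hvc.
have S0 : 0 <= \sum_j cz * `|s j|.
  by apply: sumr_ge0 => j _; rewrite mulr_ge0 // ltW.
set C := \sum_j cz * `|s j| + ch; have C0 : 0 < C by rewrite /C; lra.
have bnd l t : 0 <= l <= K -> vertex_ctrl D t ->
    - C <= \sum_(j < n) spin D j l t * s j + vertex_cost D l t.
  move=> hl Ot; have [h _] := hvc l l t hl hl Ot.
  suff : `|\sum_(j < n) spin D j l t * s j| <= \sum_j cz * `|s j|.
    by move: h; rewrite !ler_norml /C => /andP[+ _] /andP[+ _]; lra.
  apply: le_trans (ler_norm_sum _ _ _) _; apply: ler_sum => j _.
  by apply: normM_le; have [] := hsp j l l t hl hl Ot.
exists C => // l m hl hm; apply: (dist_inf_image (c := - C)) => //.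
- by move=> t Ot; exact: bnd.
- by move=> t Ot; exact: bnd.
move=> t Ot; rewrite opprD addrACA -sumrB /C mulrDl.
apply: le_trans (ler_normD _ _) _; apply: lerD; last first.
  by have [] := hvc l m t hl hm Ot.
apply: le_trans (ler_norm_sum _ _ _) _; rewrite mulr_suml.
apply: ler_sum => j _; rewrite -mulrBl mulrAC.
by apply: normM_le; have [] := hsp j l m t hl hm Ot.
Qed.

End Hamiltonians.

(** * Quadratic test functions *)

Section TestFunctions.
Context {R : realType}.

(** Properness makes limits along this filter unique, which turns a convergent difference quotient
    into a value of [derive_in], also at the ends. *)
Lemma within_itv_dnbhs_proper (a b x : R) : a < b -> a <= x <= b ->
  ProperFilter (within `[a, b] x^').
Proof.
move=> ab /andP[ax xb]; apply: Build_ProperFilter_ex => P.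
rewrite /within /= => -[e /= e0 eP].
have pick y : y \in `[a, b] -> `|x - y| < e -> y != x -> exists z, P z.
  by move=> yab xye yx; exists y; apply: eP.
have [xltb|bx] := ltP x b.
  pose m := Num.min e (b - x).
  have m0 : 0 < m by rewrite lt_min e0 subr_gt0.
  have me : m <= e by rewrite ge_min lexx.
  have mb : m <= b - x by rewrite ge_min lexx orbT.
  apply: (pick (x + m / 2)).
  - by rewrite in_itv /=; apply/andP; split; lra.
  - by rewrite opprD addrA subrr sub0r normrN gtr0_norm; lra.
  - by rewrite gt_eqF //; lra.
pose m := Num.min e (x - a).
have m0 : 0 < m by rewrite lt_min e0 subr_gt0; lra.
have me : m <= e by rewrite ge_min lexx.
have mb : m <= x - a by rewrite ge_min lexx orbT.
apply: (pick (x - m / 2)).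
- by rewrite in_itv /=; apply/andP; split; lra.
- by rewrite opprB addrCA subrr addr0 gtr0_norm; lra.
- by rewrite lt_eqF //; lra.
Qed.

(** Agreement on the interval alone is what is available when [f] is itself a [dx], computed only on
    the ray. *)
Lemma diff_quot_cvg (a b x d : R) (f g : R -> R) : a <= x <= b ->
  (forall y, a <= y <= b -> f y = g y) -> is_derive x 1 g d ->
  diff_quot f x @ within `[a, b] x^' --> d.
Proof.
move=> axb fg [dg gd]; apply/cvgrPdist_lt => e e0.
have /cvgrPdist_lt/(_ _ e0) : (fun h => h^-1 *: ((g \o shift x) (h *: 1) - g x)) @ 0^' --> d.
  by rewrite -gd; exact: dg.
move=> [r /= r0 rP]; exists r => //= y xyr yx yab.
have y0 : y - x != 0 by rewrite subr_eq0.
rewrite /diff_quot !fg ?axb//.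
have := rP (y - x); rewrite /= sub0r normrN distrC xyr => /(_ isT y0).
by rewrite -[_%:A]/((y - x) * 1) mulr1 subrK mulrC.
Qed.

Lemma derivable_in_itv (a b x d : R) (f g : R -> R) : a < b -> a <= x <= b ->
  (forall y, a <= y <= b -> f y = g y) -> is_derive x 1 g d ->
  derivable_in `[a, b] f x /\ derive_in `[a, b] f x = d.
Proof.
move=> ab axb fg gd; have H := diff_quot_cvg axb fg gd.
have F := within_itv_dnbhs_proper ab axb.
by split; [exact: (cvgP d)|exact: cvg_lim].
Qed.

Lemma is_derive_quadratic (k b c x : R) :
  is_derive x 1 (fun y => k + b * y + c * y ^+ 2) (b + 2 * c * x).
Proof. by apply: is_derive_eq; rewrite /GRing.scale /=; ring. Qed.

Lemma within_continuous_eq (T : topologicalType) (A : set T) (f g : T -> R) :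
  (forall t, A t -> f t = g t) -> continuous g -> {within A, continuous f}.
Proof.
move=> fg cg; apply/(subspace_eq_continuous (f := g)).
  by move=> t /set_mem At; exact/esym/fg.
exact: continuous_subspaceT.
Qed.

Context {n : nat} (D : system R n).
Hypotheses (X0 : 0 < ray_length D) (K0 : 0 < horizon D).

Variables (psi psi' : R -> R) (b c : 'I_n -> R).
Hypothesis psiP : forall l : R, is_derive l 1 psi (psi' l).
Hypothesis psi'_cont : continuous psi'.

(** All rays share the value [psi l] at the vertex, so gluing is automatic while the slopes [b i]
    stay independent. *)
Definition quadratic_test (i : 'I_n) (x l : R) : R := psi l + b i * x + c i * x ^+ 2.

Let dxP f i x l : 0 <= x <= ray_length D ->
  (forall y, 0 <= y <= ray_length D -> f y l = quadratic_test i y l) ->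
  derivable_in (xset D) (f^~ l) x /\ dx D f x l = b i + 2 * c i * x.
Proof.
move=> hx ff; apply: (derivable_in_itv X0 hx (g := quadratic_test i ^~ l)) => //.
exact: is_derive_quadratic.
Qed.

Lemma dx_quadratic_test i x l : 0 <= x <= ray_length D ->
  dx D (quadratic_test i) x l = b i + 2 * c i * x.
Proof. by move=> hx; have [] := @dxP (quadratic_test i) i x l hx (fun y _ => erefl). Qed.

Let dxxP i x l : 0 <= x <= ray_length D ->
  derivable_in (xset D) ((dx D (quadratic_test i))^~ l) x /\
  dxx D (quadratic_test i) x l = 2 * c i.
Proof.
move=> hx.
apply: (derivable_in_itv X0 hx (g := fun y => b i + (2 * c i) * y + 0 * y ^+ 2)).
  by move=> y hy; rewrite dx_quadratic_test// mul0r addr0.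
by apply: is_derive_eq; rewrite /GRing.scale /=; ring.
Qed.

Lemma dxx_quadratic_test i x l : 0 <= x <= ray_length D ->
  dxx D (quadratic_test i) x l = 2 * c i.
Proof. by move=> hx; have [] := @dxxP i x l hx. Qed.

Let dlP i l : 0 <= l <= horizon D ->
  derivable_in (lset D) (quadratic_test i 0) l /\
  dl D (quadratic_test i) 0 l = psi' l.
Proof.
move=> hl; apply: (derivable_in_itv K0 hl (g := psi)) => //.
by move=> y _; rewrite /quadratic_test; ring.
Qed.

Lemma dl_quadratic_test i l : 0 <= l <= horizon D ->
  dl D (quadratic_test i) 0 l = psi' l.
Proof. by move=> hl; have [] := @dlP i l hl. Qed.

Lemma quadratic_testP : test_function D quadratic_test.
Proof.
have psi_cont : continuous psi.
  move=> l; apply: differentiable_continuous; apply/derivable1_diffP.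
  by have [] := psiP l.
have itvE a (y : R) : `[0, a]%classic y -> 0 <= y <= a by rewrite /= in_itv.
have quad_cont (f : R -> R) b' c' : continuous f ->
    continuous (fun p : R * R => f p.2 + b' * p.1 + c' * p.1 ^+ 2).
  move=> cf p; apply: cvgD; first apply: cvgD.
  - by apply: (continuous_comp (f := snd)); [exact: cvg_snd|exact: cf].
  - by apply: cvgM; [exact: cvg_cst|exact: cvg_fst].
  - apply: cvgM; [exact: cvg_cst|].
    by rewrite expr2; apply: cvgM; exact: cvg_fst.
split.
- move=> i; split.
  + by apply: (within_continuous_eq (fun t _ => erefl)); exact: quad_cont.
  + by move=> x l /itvE hx _; have [] := @dxP (quadratic_test i) i x l hx (fun y _ => erefl).
  + apply: (within_continuous_eq (g := fun p => b i + 2 * c i * p.1 + 0 * p.1 ^+ 2)).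
      by move=> [x l] [/= /itvE hx _]; rewrite dx_quadratic_test// mul0r addr0.
    by apply: (quad_cont (fun=> b i)) => ?; exact: cvg_cst.
  + by move=> x l /itvE hx _; have [] := @dxxP i x l hx.
  + apply: (within_continuous_eq (g := fun=> 2 * c i)); last by move=> ?; exact: cvg_cst.
    by move=> [x l] [/= /itvE hx _]; rewrite dxx_quadratic_test.
- by move=> i j l _; rewrite /quadratic_test; ring.
- move=> i; split.
  + apply: (within_continuous_eq (g := psi)) => // t _.
    by rewrite /quadratic_test; ring.
  + by move=> l /itvE hl; have [] := @dlP i l hl.
  + by apply: (within_continuous_eq (g := psi')) => // l /itvE hl; have [] := @dlP i l hl.
Qed.

End TestFunctions.

(** * Testing with quadratic functions *)

Section Viscosity.
Context {R : realType} {n : nat} (D : system R n).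
Let X := ray_length D.
Let K := horizon D.

(** The value slot of [H] carries [v x l]: an additive constant brings the test function into
    contact without changing its derivatives. *)
Definition ray_sub (H : R -> R -> R -> R -> R -> R) (v : R -> R -> R) :=
  forall A l1 b c x l : R, 0 < x < X -> 0 < l < K ->
  (exists2 e : R, 0 < e & forall y m : R, 0 <= y <= X -> 0 <= m <= K ->
     `|x - y| < e -> `|l - m| < e ->
     v y m - (A * (m - l1) ^+ 2 + b * y + c * y ^+ 2)
       <= v x l - (A * (l - l1) ^+ 2 + b * x + c * x ^+ 2)) ->
  H x l (v x l) (b + 2 * c * x) (2 * c) <= 0.

(** [F] is abstract so that the notion serves both [v] and, after reflection, [- u]. A ball around
    the vertex is [y < e] on every ray. *)
Definition vertex_sub (F : R -> ('I_n -> R) -> R) (v : 'I_n -> R -> R -> R) :=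
  forall i (psi psi' : R -> R) b c l,
  (forall m : R, is_derive m 1 psi (psi' m)) -> continuous psi' -> 0 < l < K ->
  (exists2 e : R, 0 < e & forall j y m, 0 <= y <= X -> 0 <= m <= K ->
     y < e -> `|l - m| < e ->
     v j y m - (psi m + b j * y + c j * y ^+ 2) <= v i 0 l - psi l) ->
  0 <= psi' l + F l b.

(** Reflection makes [- u] a sub solution for [opp_ham H] when [u] is a super solution for [H], so
    later estimates are proved for sub solutions only. *)
Definition opp_ham (H : R -> R -> R -> R -> R -> R) x l r p q :=
  - H x l (- r) (- p) (- q).

Hypotheses (X0 : 0 < X) (K0 : 0 < K).

Let bump (A l1 k : R) (m : R) : R := k + A * (m - l1) ^+ 2.
Let bump' (A l1 : R) (m : R) : R := 2 * A * (m - l1).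

Let bumpP A l1 k (m : R) : is_derive m 1 (bump A l1 k) (bump' A l1 m).
Proof. by apply: is_derive_eq; rewrite /bump' /GRing.scale /=; ring. Qed.

Let bump'_cont A l1 : continuous (bump' A l1).
Proof.
move=> m; apply: cvgM; [exact: cvg_cst|].
by apply: cvgB; [exact: cvg_id|exact: cvg_cst].
Qed.

Lemma subsolution_ray_sub v i : subsolution D v -> ray_sub (ham D i) (v i).
Proof.
move=> [_ hv] A l1 b c x l hx hl [e e0 he].
pose k := v i x l - (A * (l - l1) ^+ 2 + b * x + c * x ^+ 2).
pose phi := quadratic_test (bump A l1 k) (fun _ : 'I_n => b) (fun=> c).
have phiT : test_function D phi := quadratic_testP X0 K0 _ _ (@bumpP A l1 k) (@bump'_cont A l1).
have hx2 : 0 <= x <= ray_length D by case/andP: hx => /ltW -> /ltW.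
have hx' : xset D x by rewrite /xset /= in_itv.
have hl2 : 0 <= l <= horizon D by case/andP: hl => /ltW -> /ltW.
have hl' : lset D l by rewrite /lset /= in_itv.
have [] := hv phi phiT x i l hx' hl'.
(* Points of another ray lie at distance at least [x], so a radius at most [x] confines the test to
   ray [i]. *)
- exists (Num.min e x); first by rewrite lt_min e0; case/andP: hx.
  move=> y j m; rewrite /xset /lset /= !in_itv /= => hy hm.
  rewrite !lt_min /geodist => + /andP[hme _].
  case: eqVneq => [<-|_] /andP[hxy hxy2].
    have := he y m hy hm hxy hme.
    by rewrite /phi /quadratic_test /bump; lra.
  by move: hxy2 hy; lra.
- by rewrite /phi /quadratic_test /bump /k; ring.
move=> /(_ hx hl) + _; rewrite /ray_operator dx_quadratic_test//.
rewrite dxx_quadratic_test//.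
by have -> : phi i x l = v i x l by rewrite /phi /quadratic_test /bump /k; ring.
Qed.

Lemma supersolution_ray_sub u i : supersolution D u ->
  ray_sub (opp_ham (ham D i)) (fun x l => - u i x l).
Proof.
move=> [_ hu] A l1 b c x l hx hl [e e0 he].
pose k := u i x l + (A * (l - l1) ^+ 2 + b * x + c * x ^+ 2).
pose phi := quadratic_test (bump (- A) l1 k) (fun _ : 'I_n => - b) (fun=> - c).
have phiT : test_function D phi := quadratic_testP X0 K0 _ _ (@bumpP _ l1 k) (@bump'_cont _ l1).
have hx2 : 0 <= x <= ray_length D by case/andP: hx => /ltW -> /ltW.
have hx' : xset D x by rewrite /xset /= in_itv.
have hl2 : 0 <= l <= horizon D by case/andP: hl => /ltW -> /ltW.
have hl' : lset D l by rewrite /lset /= in_itv.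
have [] := hu phi phiT x i l hx' hl'.
- exists (Num.min e x); first by rewrite lt_min e0; case/andP: hx.
  move=> y j m; rewrite /xset /lset /= !in_itv /= => hy hm.
  rewrite !lt_min /geodist => + /andP[hme _].
  case: eqVneq => [<-|_] /andP[hxy hxy2].
    have := he y m hy hm hxy hme.
    by rewrite /phi /quadratic_test /bump; lra.
  by move: hxy2 hy; lra.
- by rewrite /phi /quadratic_test /bump /k; ring.
move=> /(_ hx hl) + _; rewrite /ray_operator dx_quadratic_test//.
rewrite dxx_quadratic_test//.
have -> : phi i x l = u i x l by rewrite /phi /quadratic_test /bump /k; ring.
rewrite /opp_ham oppr_le0 opprK -[- (2 * c)]mulrN.
by have -> : - (b + 2 * c * x) = - b + 2 * - c * x by ring.
Qed.

Lemma subsolution_vertex_sub v : subsolution D v -> vertex_sub (vertex_ham D) v.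
Proof.
move=> [_ hv] i psi psi' b c l dpsi cpsi hl [e e0 he].
pose phi := quadratic_test (fun m => (v i 0 l - psi l) + psi m) b c.
have dpsi2 (m : R) : is_derive m 1 (fun m => (v i 0 l - psi l) + psi m) (psi' m).
  by apply: is_derive_eq; ring.
have phiT : test_function D phi := quadratic_testP X0 K0 _ _ dpsi2 cpsi.
have hx' : xset D 0 by rewrite /xset /= in_itv /= lexx ltW.
have hl2 : 0 <= l <= horizon D by case/andP: hl => /ltW -> /ltW.
have hl' : lset D l by rewrite /lset /= in_itv.
have [] := hv phi phiT 0 i l hx' hl'.
- exists e => // y j m; rewrite /xset /lset /= !in_itv /= => hy hm.
  have -> : geodist 0 i y j = y.
    rewrite /geodist; case: ifP => _; last by rewrite add0r.
    by rewrite sub0r normrN ger0_norm; case/andP: hy.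
  move=> hye hme; have := he j y m hy hm hye hme.
  by rewrite /phi /quadratic_test; lra.
- by rewrite /phi /quadratic_test; ring.
move=> _ /(_ erefl hl); rewrite /vertex_operator.
rewrite (dl_quadratic_test K0 _ _ dpsi2)//.
rewrite -/(vertex_ham D l (fun j => dx D (phi j) 0 l)).
suff -> : (fun j => dx D (phi j) 0 l) = b by [].
by apply/funext => j; rewrite dx_quadratic_test ?mulr0 ?addr0 // lexx ltW.
Qed.

Lemma supersolution_vertex_sub u : supersolution D u ->
  vertex_sub (fun l s => - vertex_ham D l (fun j => - s j)) (fun j x l => - u j x l).
Proof.
move=> [_ hu] i psi psi' b c l dpsi cpsi hl [e e0 he].
pose phi := quadratic_test (fun m => (u i 0 l + psi l) - psi m)
   (fun j => - b j) (fun j => - c j).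
have dpsi2 (m : R) : is_derive m 1 (fun m => (u i 0 l + psi l) - psi m) (- psi' m).
  by apply: is_derive_eq; ring.
have cpsi2 : continuous (fun m => - psi' m) by move=> m; apply: cvgN; exact: cpsi.
have phiT : test_function D phi := quadratic_testP X0 K0 _ _ dpsi2 cpsi2.
have hx' : xset D 0 by rewrite /xset /= in_itv /= lexx ltW.
have hl2 : 0 <= l <= horizon D by case/andP: hl => /ltW -> /ltW.
have hl' : lset D l by rewrite /lset /= in_itv.
have [] := hu phi phiT 0 i l hx' hl'.
- exists e => // y j m; rewrite /xset /lset /= !in_itv /= => hy hm.
  have -> : geodist 0 i y j = y.
    rewrite /geodist; case: ifP => _; last by rewrite add0r.
    by rewrite sub0r normrN ger0_norm; case/andP: hy.
  move=> hye hme; have := he j y m hy hm hye hme.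
  by rewrite /phi /quadratic_test; lra.
- by rewrite /phi /quadratic_test; ring.
move=> _ /(_ erefl hl); rewrite /vertex_operator.
rewrite (dl_quadratic_test K0 _ _ dpsi2)//.
rewrite -/(vertex_ham D l (fun j => dx D (phi j) 0 l)).
suff -> : (fun j => dx D (phi j) 0 l) = (fun j => - b j).
  by lra.
by apply/funext => j; rewrite dx_quadratic_test ?mulr0 ?addr0 // lexx ltW.
Qed.

End Viscosity.

(** * Slices *)

Section Slices.
Context {R : realType} {n : nat} (D : system R n).
Let X := ray_length D.
Let K := horizon D.

Lemma cont_xl_dist v (x l e : R) : cont_xl D v -> 0 <= x <= X -> 0 <= l <= K ->
  0 < e -> exists2 d : R, 0 < d & forall y m : R, 0 <= y <= X -> 0 <= m <= K ->
    `|x - y| < d -> `|l - m| < d -> `|v x l - v y m| < e.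
Proof.
move=> /subspace_continuousP cv hx hl e0.
have xl : (xset D `*` lset D) (x, l) by rewrite /xset /lset /= !in_itv /=.
have /cvgrPdist_lt/(_ _ e0) := cv _ xl.
rewrite near_withinE => /nbhs_ballP[d /= d0 dP]; exists d => // y m hy hm xy lm.
by apply: (dP (y, m)) => //=; rewrite /xset /lset /= !in_itv /=.
Qed.

Lemma cont_xlN v : cont_xl D v -> cont_xl D (fun x l => - v x l).
Proof. by move=> cv p; apply: continuousN => ?; exact: cv. Qed.

(** Degenerate rectangles are allowed, which also gives maxima over a time slice and over the vertex
    line. *)
Lemma cont_xl_max v (f : R * R -> R) (x1 x2 l1 l2 : R) : cont_xl D v ->
  continuous f -> 0 <= x1 -> x1 <= x2 -> x2 <= X -> 0 <= l1 -> l1 <= l2 -> l2 <= K ->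
  exists x l, [/\ x1 <= x <= x2, l1 <= l <= l2 & forall y m : R, x1 <= y <= x2 ->
    l1 <= m <= l2 -> v y m - f (y, m) <= v x l - f (x, l)].
Proof.
move=> cv cf x10 x12 x2X l10 l12 l2K.
pose A := `[x1, x2]%classic `*` `[l1, l2]%classic.
have A0 : A !=set0.
  by exists (x1, l1); rewrite /A /= !in_itv /= !lexx x12.
have cA : compact A by apply: compact_setX; exact: segment_compact.
have cvf : {within A, continuous (fun p => v p.1 p.2 - f p)}.
  have cv' : {within A, continuous (fun p => v p.1 p.2)}.
    apply: continuous_subspaceW cv => -[x l]; rewrite /xset /lset /A /= !in_itv /=.
    by move=> [/andP[? ?] /andP[? ?]]; split; apply/andP; split; rewrite -/X -/K; lra.
  move=> p; apply: continuousB; first exact: cv'.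
  by apply: continuous_subspaceT.
have [[x l] + maxP] := compact_EVT_max A0 cA cvf.
rewrite inE /A /= !in_itv /= => -[hx hl]; exists x, l; split => // y m hy hm.
by apply: (maxP (y, m)); rewrite inE /A /= !in_itv.
Qed.

Variables (H : R -> R -> R -> R -> R -> R) (C : R) (v : R -> R -> R).
Hypotheses (C0 : 0 < C) (H_lip : ham_lipschitz D C H).
Hypotheses (v_cont : cont_xl D v) (v_sub : ray_sub D H v).

Let quad_cont A l (b c : R) :
  continuous (fun p : R * R => A * (p.2 - l) ^+ 2 + b * p.1 + c * p.1 ^+ 2).
Proof.
move=> p; apply: cvgD; first apply: cvgD.
- apply: cvgM; [exact: cvg_cst|]; rewrite expr2; apply: cvgM.
  + by apply: cvgB; [exact: cvg_snd|exact: cvg_cst].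
  + by apply: cvgB; [exact: cvg_snd|exact: cvg_cst].
- by apply: cvgM; [exact: cvg_cst|exact: cvg_fst].
- by apply: cvgM; [exact: cvg_cst|]; rewrite expr2; apply: cvgM; exact: cvg_fst.
Qed.

Let sqr_dist (x y r : R) : `|x - y| = r -> (y - x) ^+ 2 = r ^+ 2.
Proof. by move=> <-; rewrite real_normK ?num_real //; ring. Qed.

(* A penalisation [A * (m - l) ^+ 2] with [A] large keeps the maximum away from
   the two sides [m = l - r'] and [m = l + r'] of the box. *)
Lemma ray_sub_box (x l b c r r' : R) : 0 < r -> 0 < r' ->
  0 <= x - r -> x + r <= X -> 0 <= l - r' -> l + r' <= K ->
  (forall y m : R, `|x - y| = r -> `|l - m| <= r' ->
     v y m - (b * y + c * y ^+ 2) < v x l - (b * x + c * x ^+ 2)) ->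
  exists y m : R, [/\ `|x - y| < r, `|l - m| < r' &
    H y m (v y m) (b + 2 * c * y) (2 * c) <= 0].
Proof.
move=> r0 r'0 b1 b3 b4 b6; set g := v x l - _ => side.
have [b2 b5] : x - r <= x + r /\ l - r' <= l + r' by split; lra.
have [xm [lm [hxm hlm maxM]]] := cont_xl_max v_cont (@quad_cont 0 0 b c) b1 b2 b3 b4 b5 b6.
set M := v xm lm - _ in maxM.
have {hxm hlm}maxM y m : `|x - y| <= r -> `|l - m| <= r' ->
    v y m - (b * y + c * y ^+ 2) <= M.
  rewrite !ler_distlC => hy hm.
  by have := maxM y m hy hm; rewrite /= !mul0r !add0r.
have Mg : g <= M by apply: maxM; rewrite subrr normr0 ltW.
(* At distance [r'] from [l] the penalty equals [M - g + 1], so the penalised function is at most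
   [g - 1] there, below its value [g] at the centre. *)
pose A := (M - g + 1) / r' ^+ 2.
have Ar : A * r' ^+ 2 = M - g + 1 by rewrite /A divfK // expf_neq0 // gt_eqF.
have A0 : 0 <= A by rewrite /A divr_ge0 ?exprn_ge0 ?(ltW r'0) // addr_ge0 // subr_ge0.
have [xs [ls [hxs hls maxA]]] := cont_xl_max v_cont (@quad_cont A l b c) b1 b2 b3 b4 b5 b6.
have ge_center : g <= v xs ls - (A * (ls - l) ^+ 2 + b * xs + c * xs ^+ 2).
  have := maxA x l; rewrite /= subrr expr0n /= mulr0 add0r; apply.
    by rewrite -ler_distlC subrr normr0 ltW.
  by rewrite -ler_distlC subrr normr0 ltW.
have Als : 0 <= A * (ls - l) ^+ 2 by rewrite mulr_ge0 // sqr_ge0.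
have lls : `|l - ls| <= r' by rewrite ler_distlC.
have xxs : `|x - xs| <= r by rewrite ler_distlC.
have ls1 : `|l - ls| < r'.
  rewrite lt_neqAle lls andbT; apply/negP => /eqP/sqr_dist h.
  have := maxM xs ls xxs lls.
  by move: ge_center; rewrite h Ar; lra.
have xs1 : `|x - xs| < r.
  rewrite lt_neqAle xxs andbT; apply/negP => /eqP h.
  have := side xs ls h lls.
  by move: ge_center Als; lra.
exists xs, ls; split => //.
move: xs1 ls1; rewrite !ltr_distlC => /andP[x3 x4] /andP[l3 l4].
apply: (v_sub (A := A) (l1 := l)).
- by rewrite (le_lt_trans b1 x3) (lt_le_trans x4 b3).
- by rewrite (le_lt_trans b4 l3) (lt_le_trans l4 b6).
exists (Num.min (Num.min (xs - (x - r)) (x + r - xs)) (Num.min (ls - (l - r')) (l + r' - ls))).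
  by rewrite !lt_min (subr_gt0 (x - r)) (subr_gt0 xs) (subr_gt0 (l - r')) (subr_gt0 ls) x3 x4 l3 l4.
move=> y m hy hm; rewrite !lt_min => /andP[/andP[y1 y2] _] /andP[_ /andP[m1 m2]].
apply: (maxA y m).
- by move: y1 y2; rewrite !ltr_norml=> /andP[? ?] /andP[? ?]; apply/andP; split; lra.
- by move: m1 m2; rewrite !ltr_norml=> /andP[? ?] /andP[? ?]; apply/andP; split; lra.
Qed.

(** The extra terms are the derivatives of a bending [k * (y - x) ^+ 2] of the quadratic; for small
    [k] strict positivity survives both bending and displacement. *)
Lemma ham_gt0_near (x l b c : R) : 0 < x < X -> 0 < l < K ->
  0 < H x l (v x l) (b + 2 * c * x) (2 * c) ->
  exists2 k, 0 < k & exists2 r, 0 < r & forall y m : R, 0 <= y <= X -> 0 <= m <= K ->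
    `|x - y| <= r -> `|l - m| <= r ->
    0 < H y m (v y m) (b + 2 * c * y + 2 * k * (y - x)) (2 * c + 2 * k).
Proof.
move=> hx hl; set eta := H _ _ _ _ _ => H0.
(* The four error terms will add up to at most [4 * k], so [H] changes by at most a quarter of
   [eta]. *)
have [k k0 kC] : exists2 k, 0 < k & C * k = eta / 16.
  exists (eta / (16 * C)); first by rewrite divr_gt0 // mulr_gt0.
  by field; rewrite gt_eqF.
exists k => //.
have hx2 : 0 <= x <= X by case/andP: hx => /ltW -> /ltW.
have hl2 : 0 <= l <= K by case/andP: hl => /ltW -> /ltW.
have [d d0 dP] := cont_xl_dist v_cont hx2 hl2 k0.
pose P := 1 + `|b + 2 * c * x| + `|2 * c|.
have P0 : 0 <= P by rewrite /P !addr_ge0.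
pose N := 2 * P + 2 * k + 2 * `|c|.
have N0 : 0 < N by rewrite /N; have := normr_ge0 c; lra.
pose r := Num.min (d / 2) (k / N).
have r0 : 0 < r by rewrite lt_min (divr_gt0 k0 N0) divr_gt0.
have rd : r < d.
  by apply: (@le_lt_trans _ _ (d / 2)); [rewrite ge_min lexx|lra].
have rN : r * N <= k by rewrite -ler_pdivlMr // ge_min lexx orbT.
exists r => // y m hy hm xy lm.
have vv : `|v x l - v y m| < k by apply: dP => //; apply: le_lt_trans rd.
have pp : `|b + 2 * c * x - (b + 2 * c * y + 2 * k * (y - x))| <= (2 * k + 2 * `|c|) * r.
  have -> : b + 2 * c * x - (b + 2 * c * y + 2 * k * (y - x)) = (2 * k + 2 * c) * (x - y).
    by ring.
  have kc : `|2 * k + 2 * c| <= 2 * k + 2 * `|c|.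
    apply: le_trans (ler_normD _ _) _.
    by rewrite !normrM (gtr0_norm k0) (@ger0_norm _ 2).
  by rewrite normrM; apply: ler_pM.
have qq : `|2 * c - (2 * c + 2 * k)| <= 2 * k.
  by rewrite opprD addrA subrr sub0r normrN gtr0_norm // mulr_gt0.
have := H_lip (v x l) (v y m) (b + 2 * c * x) (b + 2 * c * y + 2 * k * (y - x))
  (2 * c) (2 * c + 2 * k) hx2 hy hl2 hm.
rewrite -/P -/eta.
have h1 : (`|x - y| + `|l - m|) * P <= (2 * r) * P.
  by apply: ler_wpM2r => //; move: xy lm; lra.
have h2 : (`|x - y| + `|l - m|) * P + `|v x l - v y m| +
    `|b + 2 * c * x - (b + 2 * c * y + 2 * k * (y - x))| +
    `|2 * c - (2 * c + 2 * k)| <= 4 * k.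
  by move: h1 vv pp qq rN; rewrite /N; lra.
have := ler_wpM2l (ltW C0) h2; move: kC H0.
by rewrite ler_norml => kC H0 h3 /andP[_ h4]; lra.
Qed.

(** A maximum on the slice alone suffices, since [H] sees no derivative in [l]. If [H] were
    positive, bending the quadratic by [k * (y - x) ^+ 2] would make the maximum strict in [x],
    hence stable under small changes of [l]; [ray_sub_box] would give a nearby point with [H <= 0],
    against [ham_gt0_near]. *)
Lemma ray_sub_slice (x l b c e : R) : 0 < x < X -> 0 < l < K -> 0 < e ->
  (forall y : R, 0 <= y <= X -> `|x - y| < e ->
     v y l - (b * y + c * y ^+ 2) <= v x l - (b * x + c * x ^+ 2)) ->
  H x l (v x l) (b + 2 * c * x) (2 * c) <= 0.
Proof.
move=> hx hl e0 he; rewrite leNgt; apply/negP => H0.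
have [k k0 [d d0 dP]] := ham_gt0_near hx hl H0.
pose b' := b - 2 * k * x; pose c' := c + k.
have quadE y : b' * y + c' * y ^+ 2 = b * y + c * y ^+ 2 + k * (y - x) ^+ 2 - k * x ^+ 2.
  by rewrite /b' /c'; ring.
have [r [r0 re rd [rx rX rl rK]]] : exists r : R, [/\ 0 < r, r < e, r <= d
    & [/\ r <= x, r <= X - x, r <= l & r <= K - l]].
  exists (Num.min (Num.min (e / 2) d) (Num.min (Num.min x (X - x)) (Num.min l (K - l)))).
  case/andP: hx => x1 x2; case/andP: hl => l1 l2; split.
  - by rewrite !lt_min d0 x1 l1 subr_gt0 x2 subr_gt0 l2 divr_gt0.
  - by apply: (@le_lt_trans _ _ (e / 2)); [rewrite !ge_min lexx|lra].
  - by rewrite !ge_min lexx !orbT.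
  - by split; rewrite !ge_min lexx ?orbT.
have hl2 : 0 <= l <= K by case/andP: hl => /ltW -> /ltW.
have yX y : `|x - y| = r -> 0 <= y <= X.
  move=> /eqP; rewrite eq_le ler_distlC => /andP[/andP[h1 h2] _].
  by rewrite (le_trans _ h1) ?subr_ge0 // (le_trans h2) // addrC -lerBrDr.
(* Bending gains [k * r ^+ 2] at distance [r]; half of it absorbs the variation of [v] in [l]. *)
have kr0 : 0 < k * r ^+ 2 / 2 by rewrite divr_gt0 // mulr_gt0 // exprn_gt0.
have xr1 : `|x - (x + r)| = r by rewrite opprD addrA subrr sub0r normrN gtr0_norm.
have xr2 : `|x - (x - r)| = r by rewrite opprB addrCA subrr addr0 gtr0_norm.
have [d1 d10 d1P] := cont_xl_dist v_cont (yX _ xr1) hl2 kr0.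
have [d2 d20 d2P] := cont_xl_dist v_cont (yX _ xr2) hl2 kr0.
pose r' := Num.min r (Num.min (d1 / 2) (d2 / 2)).
have r'0 : 0 < r' by rewrite !lt_min r0 !divr_gt0.
have rr : r' <= r by rewrite ge_min lexx.
have rd1 : r' < d1.
  by apply: (@le_lt_trans _ _ (d1 / 2)); [rewrite !ge_min lexx ?orbT|lra].
have rd2 : r' < d2.
  by apply: (@le_lt_trans _ _ (d2 / 2)); [rewrite !ge_min lexx ?orbT|lra].
have mK m : `|l - m| <= r' -> 0 <= m <= K.
  move=> /le_trans/(_ rr); rewrite ler_distlC => /andP[h1 h2].
  by rewrite (le_trans _ h1) ?subr_ge0 // (le_trans h2) // addrC -lerBrDr.
have side y m : `|x - y| = r -> `|l - m| <= r' ->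
    v y m - (b' * y + c' * y ^+ 2) < v x l - (b' * x + c' * x ^+ 2).
  move=> xy lm.
  have vy : `|v y l - v y m| < k * r ^+ 2 / 2.
    have [->|->] : y = x + r \/ y = x - r.
      move: xy; case: (lerP 0 (x - y)) => h1; [right|left].
        by move: xy; rewrite ger0_norm //; lra.
      by move: xy; rewrite ltr0_norm //; lra.
    - apply: d1P => //; [exact: yX|exact: mK|by rewrite subrr normr0|].
      exact: le_lt_trans rd1.
    - apply: d2P => //; [exact: yX|exact: mK|by rewrite subrr normr0|].
      exact: le_lt_trans rd2.
  have := he y (yX y xy); rewrite xy => /(_ re).
  rewrite !quadE (sqr_dist xy) subrr expr0n /= mulr0 addr0.
  by move: vy kr0; rewrite ltr_norml=> /andP[? ?]; lra.
have b1 : 0 <= x - r by rewrite subr_ge0.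
have b2 : x + r <= X by rewrite addrC -lerBrDr.
have b3 : 0 <= l - r' by rewrite subr_ge0 (le_trans rr).
have b4 : l + r' <= K by rewrite addrC -lerBrDr (le_trans rr).
have [y [m [xy lm Hym]]] := ray_sub_box r0 r'0 b1 b2 b3 b4 side.
have hy : 0 <= y <= X.
  move: (ltW xy); rewrite ler_distlC => /andP[h1 h2].
  by rewrite (le_trans _ h1) ?subr_ge0 // (le_trans h2) // addrC -lerBrDr.
have := dP y m hy (mK _ (ltW lm)) (le_trans (ltW xy) rd) (le_trans (le_trans (ltW lm) rr) rd).
have -> : b + 2 * c * y + 2 * k * (y - x) = b' + 2 * c' * y by rewrite /b' /c'; ring.
have -> : 2 * c + 2 * k = 2 * c' by rewrite /c'; ring.
by rewrite ltNge Hym.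
Qed.

End Slices.

(** * Quadratic approximate solutions *)

Section OppHam.
Context {R : realType} {n : nat} (D : system R n).

Lemma opp_ham_lipschitz C H : ham_lipschitz D C H -> ham_lipschitz D C (opp_ham H).
Proof.
move=> hH x y l m r s p p' q q' hx hy hl hm; rewrite /opp_ham -opprD normrN.
have := hH x y l m (- r) (- s) (- p) (- p') (- q) (- q') hx hy hl hm.
by rewrite -!opprD !normrN.
Qed.

Lemma opp_ham_discounted H : ham_discounted D H -> ham_discounted D (opp_ham H).
Proof.
move=> hH x l r s p q; rewrite /opp_ham -opprD hH; ring.
Qed.

End OppHam.

(** * Comparison with quadratics on a slice, and their construction *)

Section Comparison.
Context {R : realType} {n : nat} (D : system R n).
Let X := ray_length D.
Let K := horizon D.

(** If [v] exceeded the quadratic [Z], a maximum of [v - Z] would be interior, and testing with [Z]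
    would give [H <= 0] at the value of [v]. Yet [H] is positive at the value of [Z] and increases
    with the value, by the discount. *)
Lemma slice_le (H : R -> R -> R -> R -> R -> R) (C : R) (v : R -> R -> R)
    (l z b c x1 x2 : R) :
  0 < C -> 0 < discount D -> ham_lipschitz D C H -> ham_discounted D H ->
  cont_xl D v -> ray_sub D H v -> 0 < l < K -> 0 <= x1 -> x1 <= x2 -> x2 <= X ->
  (forall x : R, x1 <= x <= x2 -> 0 < H x l (z + b * x + c * x ^+ 2) (b + 2 * c * x) (2 * c)) ->
  v x1 l <= z + b * x1 + c * x1 ^+ 2 -> v x2 l <= z + b * x2 + c * x2 ^+ 2 ->
  forall x : R, x1 <= x <= x2 -> v x l <= z + b * x + c * x ^+ 2.
Proof.
move=> C0 lam0 Hlip Hdis vc vs hl x10 x12 x2X Hpos v1 v2 x hx.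
have cf : continuous (fun p : R * R => b * p.1 + c * p.1 ^+ 2).
  move=> p; apply: cvgD; first by apply: cvgM; [exact: cvg_cst|exact: cvg_fst].
  by apply: cvgM; [exact: cvg_cst|]; rewrite expr2; apply: cvgM; exact: cvg_fst.
have [l0 lK] : 0 <= l /\ l <= K by case/andP: hl => /ltW ? /ltW.
have [xm [lm [hxm]]] := cont_xl_max vc cf x10 x12 x2X l0 (lexx l) lK.
rewrite -eq_le => /eqP <- {lm} /= maxM.
have {}maxM y : x1 <= y <= x2 -> v y l - (b * y + c * y ^+ 2) <= v xm l - (b * xm + c * xm ^+ 2).
  by move=> hy; apply: maxM => //; rewrite lexx.
have [vm|vm] := leP (v xm l) (z + b * xm + c * xm ^+ 2).
  by have := maxM x hx; lra.
have h1 : x1 < xm.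
  by rewrite lt_neqAle; case/andP: hxm => -> _; rewrite andbT; apply/eqP => h; move: vm; rewrite -h; lra.
have h2 : xm < x2.
  by rewrite lt_neqAle; case/andP: hxm => _ ->; rewrite andbT; apply/eqP => h; move: vm; rewrite h; lra.
have hm : 0 < xm < X by rewrite (le_lt_trans x10 h1) (lt_le_trans h2 x2X).
have e0 : 0 < Num.min (xm - x1) (x2 - xm) by rewrite lt_min !subr_gt0 h1 h2.
have : H xm l (v xm l) (b + 2 * c * xm) (2 * c) <= 0.
  apply: (ray_sub_slice C0 Hlip vc vs hm hl e0) => y hy.
  rewrite lt_min => /andP[y1 y2]; apply: maxM.
  by move: y1 y2; rewrite !ltr_norml => /andP[? ?] /andP[? ?]; apply/andP; split; lra.
have := Hpos xm hxm.
have := Hdis xm l (v xm l) (z + b * xm + c * xm ^+ 2) (b + 2 * c * xm) (2 * c).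
have : 0 < discount D * (v xm l - (z + b * xm + c * xm ^+ 2)) by rewrite mulr_gt0 // subr_gt0.
lra.
Qed.

Section QuadraticSolution.
Variables (H : R -> R -> R -> R -> R -> R) (C s : R).
Hypotheses (C0 : 0 < C) (s0 : 0 < s) (H_lip : ham_lipschitz D C H).
Hypotheses (H_ell : ham_elliptic D s H)
  (H_bound : forall x l, 0 <= x <= X -> 0 <= l <= K -> `|H x l 0 0 0| <= C).

(** Intermediate value theorem in [q]: [Q] is chosen so that ellipticity, worth [s * Q], outweighs
    the bound on [H] at [q = 0] plus [e]. *)
Lemma ham_solve (x l r p e : R) : 0 <= x <= X -> 0 <= l <= K -> 0 < e ->
  exists2 q, H x l r p q = e & `|q| <= (C * (1 + `|r| + `|p|) + e) / s.
Proof.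
move=> hx hl e0; set Q := _ / s.
have Q0 : 0 <= Q.
  by rewrite divr_ge0 ?(ltW s0) // addr_ge0 ?(ltW e0) // mulr_ge0 ?(ltW C0) // !addr_ge0.
have sQ : s * Q = C * (1 + `|r| + `|p|) + e by rewrite /Q mulrC divfK // gt_eqF.
have Hr0 : `|H x l r p 0| <= C * (1 + `|r| + `|p|).
  have := H_lip r 0 p 0 0 0 hx hx hl hl; have := H_bound hx hl.
  rewrite !subrr !normr0 !addr0 !subr0 mul0r add0r => h1 h2.
  rewrite -(subrK (H x l 0 0 0) (H x l r p 0)).
  by apply: le_trans (ler_normD _ _) _; lra.
have HQ : H x l r p Q <= e.
  have := H_ell r p hx hl Q0; rewrite subr0 sQ.
  by move: Hr0; rewrite ler_norml => /andP[_ ?]; lra.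
have HNQ : e <= H x l r p (- Q).
  have := H_ell r p hx hl (ltac:(by rewrite oppr_le0) : - Q <= 0); rewrite sub0r opprK sQ.
  by move: Hr0; rewrite ler_norml => /andP[? _]; lra.
have Hc : continuous (fun q => H x l r p q).
  move=> q; apply/cvgrPdist_lt => d d0; exists (d / C) => /=; first exact: divr_gt0.
  move=> q' qq'; apply: le_lt_trans (H_lip r r p p q q' hx hx hl hl) _.
  by rewrite !subrr !normr0 !addr0 mul0r !add0r mulrC -ltr_pdivlMr.
have [|||q hq Hq] := @IVT R (fun q => H x l r p q) (- Q) Q e.
- by rewrite (le_trans _ Q0) // oppr_le0.
- exact: continuous_subspaceT.
- by rewrite ge_min le_max HQ HNQ !orbT.
exists q => //; rewrite ler_norml; move: hq; by rewrite in_itv /=.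
Qed.

(* On a short interval the coefficients, [Z] and [Z'] barely vary, so a quadratic
   polynomial with prescribed end values already is an approximate solution. *)
Lemma quadratic_solution (l rb e : R) : 0 <= l <= K -> 0 <= rb -> 0 < e ->
  exists2 eta, 0 < eta & forall y d A p : R,
    0 <= y -> 0 < d -> y + d <= X -> `|A| <= rb -> d + `|p| * d <= eta ->
  exists z b c, [/\ z + b * y + c * y ^+ 2 = A,
    z + b * (y + d) + c * (y + d) ^+ 2 = A + p * d &
    forall x, y <= x <= y + d ->
      e / 4 <= H x l (z + b * x + c * x ^+ 2) (b + 2 * c * x) (2 * c) < e].
Proof.
move=> hl rb0 e0.
(* [Q0] times 1 + |p| will bound the second derivative [q] uniformly in [A], so [eta] can be fixed
   before [y], [d], [A] and [p]. *)
pose Q0 := (C * (1 + rb) + e / 2) / s.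
have Q00 : 0 <= Q0.
  rewrite divr_ge0 ?(ltW s0) // addr_ge0 ?divr_ge0 ?(ltW e0) //.
  by rewrite mulr_ge0 ?(ltW C0) // addr_ge0.
have W0 : 0 < 4 * (C * (2 + 3 * Q0)).
  by rewrite mulr_gt0 // mulr_gt0 // ltr_wpDr // mulr_ge0.
exists (Num.min 1 (e / (4 * (C * (2 + 3 * Q0))))); first by rewrite lt_min ltr01 divr_gt0.
move=> y d A p y0 d0 ydX Arb; rewrite le_min => /andP[dp1 dp2].
have hy : 0 <= y <= X.
  by rewrite y0 (le_trans _ ydX) // lerDl ltW.
have e20 : 0 < e / 2 by rewrite divr_gt0.
(* The equation is solved exactly at the left end, at level [e / 2]; the error along the interval
   will be at most [e / 4]. *)
have [q Hq qQ] := ham_solve A p hy hl e20.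
(* The chord through the two end values, minus [q / 2 * ((x - y) * (y + d - x))], which vanishes at
   both ends and gives second derivative [q]. *)
exists (A - p * y + q / 2 * y * (y + d)), (p - q * y - q * d / 2), (q / 2).
split; [by field|by field|].
move=> x /andP[yx xyd].
have hx : 0 <= x <= X by rewrite (le_trans y0 yx) (le_trans xyd ydX).
have -> : A - p * y + q / 2 * y * (y + d) + (p - q * y - q * d / 2) * x + q / 2 * x ^+ 2
   = A + (p * (x - y) - q / 2 * ((x - y) * (y + d - x))) by field.
have -> : p - q * y - q * d / 2 + 2 * (q / 2) * x = p + q / 2 * ((x - y) - (y + d - x)) by field.
have -> : 2 * (q / 2) = q by field.
set t := x - y; set t' := y + d - x.
have t0 : 0 <= t by rewrite subr_ge0.
have t'0 : 0 <= t' by rewrite subr_ge0.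
have ttd : t + t' = d by rewrite /t /t'; ring.
have pd0 : 0 <= `|p| * d by rewrite mulr_ge0 // ltW.
have d1 : d <= 1 by lra.
have td : t <= d by lra.
have t'd : t' <= d by lra.
have ttd' : `|t - t'| <= d by rewrite ler_norml; apply/andP; split; lra.
have qd0 : 0 <= `|q| * d by rewrite mulr_ge0 // ltW.
have qd : `|q| * d <= Q0 * (d + `|p| * d).
  have h : `|q| <= Q0 * (1 + `|p|).
    apply: le_trans qQ _; rewrite /Q0 mulrAC ler_wpM2r ?invr_ge0 ?(ltW s0) //.
    rewrite -subr_ge0; set S := (X in 0 <= X).
    have -> : S = C * (rb - `|A|) + C * (rb * `|p|) + e / 2 * `|p|.
      by rewrite /S; ring.
    by rewrite !addr_ge0 // mulr_ge0 ?(ltW C0) ?(ltW e20) // ?subr_ge0 // mulr_ge0.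
  have -> : Q0 * (d + `|p| * d) = Q0 * (1 + `|p|) * d by ring.
  by rewrite ler_wpM2r // ltW.
have n1 : `|x - y| * (1 + `|p| + `|q|) <= d * (1 + `|p| + `|q|).
  by rewrite ler_wpM2r ?addr_ge0 // ger0_norm.
have n2 : `|A + (p * t - q / 2 * (t * t')) - A| <= `|p| * d + `|q| * d.
  rewrite addrAC subrr add0r; apply: le_trans (ler_normB _ _) _.
  rewrite !normrM (ger0_norm t0) (ger0_norm t'0) normfV (@ger0_norm _ 2) //.
  apply: lerD; first by rewrite ler_wpM2l.
  rewrite -mulrA ler_wpM2l //.
  have : t * t' <= d * 1 by apply: ler_pM => //; lra.
  lra.
have n3 : `|p + q / 2 * (t - t') - p| <= `|q| * d.
  rewrite addrAC subrr add0r !normrM normfV (@ger0_norm _ 2) // -mulrA ler_wpM2l //.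
  by move: ttd' (normr_ge0 (t - t')); lra.
have := H_lip A (A + (p * t - q / 2 * (t * t'))) p (p + q / 2 * (t - t')) q q hy hx hl hl.
rewrite (distrC y x) (distrC A) (distrC p) !subrr normr0 !addr0 Hq.
set G := H _ _ _ _ _.
have tot : `|x - y| * (1 + `|p| + `|q|) + `|A + (p * t - q / 2 * (t * t')) - A|
   + `|p + q / 2 * (t - t') - p| <= (2 + 3 * Q0) * (d + `|p| * d).
  by move: n1 n2 n3 qd; lra.
move=> /le_trans/(_ (ler_wpM2l (ltW C0) tot)).
have : C * ((2 + 3 * Q0) * (d + `|p| * d)) <= e / 4.
  by move: dp2; rewrite ler_pdivlMr //; lra.
by rewrite ler_norml => h1 /andP[h2 h3]; apply/andP; split; lra.
Qed.

End QuadraticSolution.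

End Comparison.

(** * Comparison on a ray *)

Section Ray.
Context {R : realType} {n : nat} (D : system R n).
Let X := ray_length D.
Let K := horizon D.

Variables (H : R -> R -> R -> R -> R -> R) (C s : R).
Hypotheses (C0 : 0 < C) (s0 : 0 < s) (H_lip : ham_lipschitz D C H).
Hypotheses (H_ell : ham_elliptic D s H) (H_disc : ham_discounted D H)
  (H_bound : forall x l, 0 <= x <= X -> 0 <= l <= K -> `|H x l 0 0 0| <= C)
  (lam0 : 0 < discount D).
Variables (u v : R -> R -> R).
Hypotheses (u_cont : cont_xl D u) (v_cont : cont_xl D v) (v_sub : ray_sub D H v)
  (u_sup : ray_sub D (opp_ham H) (fun x l => - u x l)).

(** Hence [Z - M] is a strict sub solution exactly where [H] at [Z] is below [discount D * M]. *)
Let opp_ham_shift (x l M z b c : R) :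
  opp_ham H x l (M - z + - b * x + - c * x ^+ 2) (- b + 2 * - c * x) (2 * - c) =
  discount D * M - H x l (z + b * x + c * x ^+ 2) (b + 2 * c * x) (2 * c).
Proof.
rewrite /opp_ham.
have -> : - (2 * - c) = 2 * c by ring.
have -> : - (- b + 2 * - c * x) = b + 2 * c * x by ring.
have := H_disc x l (- (M - z + - b * x + - c * x ^+ 2)) (z + b * x + c * x ^+ 2)
  (b + 2 * c * x) (2 * c).
lra.
Qed.

(* [u] and [v] are separated by translates of one quadratic [Z] with [Z = v] at
   both ends: [v <= Z] and [Z - M <= u]. Equality at [x] would make [x] a minimum
   of [u - Z], although [Z - M] is a strict subsolution. *)
Lemma ray_strict_max (l M : R) : 0 < l < K -> 0 < M ->
  (forall x : R, 0 <= x <= X -> v x l - u x l <= M) ->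
  forall x : R, 0 < x < X -> v x l - u x l < M.
Proof.
move=> hl M0 uvM x hx.
have hx2 : 0 <= x <= X by case/andP: hx => /ltW -> /ltW.
have hl2 : 0 <= l <= K by case/andP: hl => /ltW -> /ltW.
rewrite lt_neqAle uvM // andbT; apply/eqP => uvx.
have e0 : 0 < discount D * M by rewrite mulr_gt0.
have rb0 : 0 <= `|v x l| + 1 by rewrite addr_ge0.
have [eta eta0 etaP] := quadratic_solution C0 s0 H_lip H_ell H_bound hl2 rb0 e0.
(* The bound 1 keeps the left end value within [rb]; [eta / 4] makes the increment of [v] over the
   interval at most [eta / 2], the length taking the other half. *)
have m0 : 0 < Num.min 1 (eta / 4) by rewrite lt_min ltr01 divr_gt0.
have [d1 d10 d1P] := cont_xl_dist v_cont hx2 hl2 m0.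
have [d [d0 dd1 deta dx dX]] : exists d : R, [/\ 0 < d, d < d1, d <= eta / 4, d <= x & d <= X - x].
  exists (Num.min (Num.min (d1 / 2) (eta / 4)) (Num.min x (X - x))).
  case/andP: hx => x1 x2; split.
  - by rewrite !lt_min !divr_gt0 // x1 subr_gt0 x2.
  - apply: (@le_lt_trans _ _ (d1 / 2)); first by rewrite !ge_min lexx.
    by rewrite ltr_pdivrMr // ltr_pMr // ltr1n.
  - by rewrite !ge_min lexx !orbT.
  - by rewrite !ge_min lexx !orbT.
  - by rewrite !ge_min lexx !orbT.
have near y : `|x - y| <= d -> 0 <= y <= X ->
    `|v x l - v y l| < Num.min 1 (eta / 4).
  by move=> xy hy; apply: d1P => //; [exact: le_lt_trans dd1|rewrite subrr normr0].
pose y := x - d.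
have dd0 : 0 < d + d by rewrite addr_gt0.
have [p pdE] : exists p, p * (d + d) = v (x + d) l - v y l.
  by exists ((v (x + d) l - v y l) / (d + d)); rewrite divfK // gt_eqF.
have xdE : y + (d + d) = x + d by rewrite /y; ring.
have y0 : 0 <= y by rewrite subr_ge0.
have ydX : y + (d + d) <= X by rewrite xdE addrC -lerBrDr.
have hy : 0 <= y <= X by rewrite y0 (le_trans _ ydX) // lerDl ltW.
have hy' : 0 <= x + d <= X by rewrite -xdE ydX addr_ge0 // ltW.
have v1 : `|v x l - v y l| < Num.min 1 (eta / 4).
  by apply: near => //; rewrite /y opprB addrCA subrr addr0 gtr0_norm.
have v2 : `|v x l - v (x + d) l| < Num.min 1 (eta / 4).
  by apply: near => //; rewrite opprD addrA subrr sub0r normrN gtr0_norm.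
move: v1 v2; rewrite !lt_min => /andP[v11 v12] /andP[_ v22].
have Arb : `|v y l| <= `|v x l| + 1.
  have -> : v y l = v x l - (v x l - v y l) by ring.
  by apply: le_trans (ler_normB _ _) _; rewrite lerD2l ltW.
have pd : (d + d) + `|p| * (d + d) <= eta.
  have -> : `|p| * (d + d) = `|v (x + d) l - v y l| by rewrite -pdE normrM (gtr0_norm dd0).
  have : `|v (x + d) l - v y l| <= `|v x l - v y l| + `|v x l - v (x + d) l|.
    have -> : v (x + d) l - v y l = (v x l - v y l) - (v x l - v (x + d) l) by ring.
    exact: ler_normB.
  by lra.
have [z [b [c [Z1 Z2 HZ]]]] := etaP y (d + d) (v y l) p y0 dd0 ydX Arb pd.
rewrite xdE in Z2 HZ.
have {}Z2 : z + b * (x + d) + c * (x + d) ^+ 2 = v (x + d) l by rewrite Z2 pdE; ring.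
have yxd : y <= x + d by rewrite -xdE lerDl ltW.
have vZ t : y <= t <= x + d -> v t l <= z + b * t + c * t ^+ 2.
  apply: (slice_le C0 lam0 H_lip H_disc v_cont v_sub hl y0 yxd).
  - by case/andP: hy'.
  - move=> {}t /HZ /andP[h _]; apply: lt_le_trans h.
    by rewrite divr_gt0.
  - by rewrite Z1.
  - by rewrite Z2.
have uc := cont_xlN u_cont.
have uZ t : y <= t <= x + d -> - u t l <= M - z + - b * t + - c * t ^+ 2.
  apply: (slice_le C0 lam0 (opp_ham_lipschitz H_lip) (opp_ham_discounted H_disc) uc u_sup hl y0 yxd).
  - by case/andP: hy'.
  - by move=> {}t /HZ /andP[_ h]; rewrite opp_ham_shift subr_gt0.
  - by have := uvM y hy; move: Z1; lra.
  - by have := uvM (x + d) hy'; move: Z2; lra.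
have yx : y <= x <= x + d by rewrite lerDl (ltW d0) /y gerBl ltW.
(* Squeeze: [v <= Z] and [v - u = M] at [x] force [u = Z - M] there. *)
have ux : - u x l = M - z + - b * x + - c * x ^+ 2.
  by apply/eqP; rewrite eq_le uZ //=; have := vZ x yx; move: uvx; lra.
have : opp_ham H x l (- u x l) (- b + 2 * - c * x) (2 * - c) <= 0.
  apply: (ray_sub_slice C0 (opp_ham_lipschitz H_lip) uc u_sup hx hl d0) => t ht.
  move=> /ltW; rewrite ler_distlC => /uZ; move: ux; lra.
rewrite ux opp_ham_shift subr_le0 leNgt.
by have /andP[_ ->] := HZ x yx.
Qed.

End Ray.

(** * Growth at the vertex *)

Lemma common_radius (R : realType) (n : nat) (P : 'I_n -> R -> Prop) :
  (forall i (r r' : R), r' <= r -> P i r -> P i r') ->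
  (forall i, exists2 r : R, 0 < r & P i r) ->
  exists2 r : R, 0 < r & forall i, P i r.
Proof.
move=> Pmono Pex; have ex i := cid2 (Pex i).
exists (\big[Num.min/1]_i sval (ex i)).
  by apply: lt_bigmin => // i _; case: (ex i).
move=> i; apply: (@Pmono i (sval (ex i))); last by case: (ex i).
exact: bigmin_le.
Qed.

Section Vertex.
Context {R : realType} {n : nat} (D : system R n).
Let X := ray_length D.
Let K := horizon D.

(** A penalty for [vertex_growth]: larger than the drop [g] at [a], yet below [g / 2] at a point [x]
    close to [a], so a maximum is pushed off [a] without losing to the other end. [B] makes the
    exponent at [x] equal to [- (2 * A / g)]. *)
Lemma exp_barrier (a y g e : R) : a < y -> 0 < g -> 0 < e ->
  exists A B x : R, [/\ 0 < A, 0 < B, a < x < y /\ x - a < e,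
    g < A & A * expR (- (B * (x - a))) < g / 2].
Proof.
move=> ay g0 e0.
pose A := g + 1; have A0 : 0 < A by rewrite addr_gt0.
pose t := Num.min (e / 2) ((y - a) / 2).
have t0 : 0 < t by rewrite lt_min !divr_gt0 // subr_gt0.
have te : t < e.
  by apply: (@le_lt_trans _ _ (e / 2)); [rewrite ge_min lexx|lra].
have ty : t < y - a.
  by apply: (@le_lt_trans _ _ ((y - a) / 2)); [rewrite ge_min lexx orbT|lra].
have B0 : 0 < 2 * A / g / t by rewrite !divr_gt0 // mulr_gt0.
exists A, (2 * A / g / t), (a + t); split => //.
- by rewrite ltrDl t0 -ltrBrDl ty /= addrAC subrr add0r.
- by rewrite /A ltrDl.
rewrite addrAC subrr add0r divfK ?gt_eqF // expRN -ltr_pdivlMl //.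
have g2 : 0 < A^-1 * (g / 2) by rewrite mulr_gt0 ?invr_gt0 // divr_gt0.
rewrite -[ltRHS]invrK ltf_pV2 ?posrE ?expR_gt0 ?invr_gt0 //.
have := expR_ge1Dx (2 * A / g); apply: lt_le_trans.
have -> : (A^-1 * (g / 2))^-1 = 2 * A / g by field; rewrite !gt_eqF.
by rewrite ltrDr.
Qed.

Section Growth.
Variables (H : 'I_n -> R -> R -> R -> R -> R -> R) (C : R).
Hypotheses (C0 : 0 < C) (H_lip : forall i, ham_lipschitz D C (H i))
  (H_disc : forall i, ham_discounted D (H i)) (lam0 : 0 < discount D) (X0 : 0 < X).
Variables (F : R -> ('I_n -> R) -> R) (CF : R) (b : 'I_n -> R).
Hypotheses (CF0 : 0 < CF) (F_lip : forall l m : R, 0 <= l <= K -> 0 <= m <= K ->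
  `|F l b - F m b| <= CF * `|l - m|).
Variable v : 'I_n -> R -> R -> R.
Hypotheses (v_cont : network_continuous D v)
  (v_ray : forall i, ray_sub D (H i) (v i)) (v_vertex : vertex_sub D F v).

(** The margin [k] in the equation and the strict inequality at [d] are open conditions, so they
    survive a small change of [l] when the quadratic is translated to start at [v i0 0 l];
    [slice_le] then applies at time [l]. *)
Lemma ray_barrier (i0 i : 'I_n) (l0 c d k : R) : 0 < l0 < K -> 0 < d -> d <= X -> 0 < k ->
  (forall x : R, 0 <= x <= d ->
     k <= H i x l0 (v i0 0 l0 + b i * x + c * x ^+ 2) (b i + 2 * c * x) (2 * c)) ->
  v i d l0 < v i0 0 l0 + b i * d + c * d ^+ 2 ->
  exists2 r : R, 0 < r & forall l : R, 0 < l < K -> `|l0 - l| < r ->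
    forall x : R, 0 <= x <= d -> v i x l <= v i0 0 l + b i * x + c * x ^+ 2.
Proof.
move=> hl0 d0 dX k0 HZ vd.
have hl02 : 0 <= l0 <= K by case/andP: hl0 => /ltW -> /ltW.
have h0 : 0 <= (0 : R) <= X by rewrite lexx ltW.
have hd : 0 <= d <= X by rewrite ltW.
have [vc vg] := v_cont.
pose g := v i0 0 l0 + b i * d + c * d ^+ 2 - v i d l0.
have g0 : 0 < g by rewrite subr_gt0.
have m0 : 0 < Num.min (g / 2) (k / (4 * C)) by rewrite lt_min !divr_gt0 // mulr_gt0.
have [r1 r10 r1P] := cont_xl_dist (vc i0) h0 hl02 m0.
have [r2 r20 r2P] := cont_xl_dist (vc i) hd hl02 m0.
(* [P] bounds the weight in [ham_lipschitz] for the derivatives of the quadratic on the whole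
   ray. *)
pose P := 1 + (`|b i| + `|2 * c| * X) + `|2 * c|.
have P0 : 0 < P by rewrite /P -addrA ltr_pwDl // !addr_ge0 // mulr_ge0 // ltW.
have r30 : 0 < k / (4 * C) / P by rewrite !divr_gt0 // mulr_gt0.
exists (Num.min (Num.min r1 r2) (k / (4 * C) / P)); first by rewrite !lt_min r10 r20.
move=> l hl; rewrite !lt_min => /andP[/andP[lr1 lr2] lr3].
have hl2 : 0 <= l <= K by case/andP: hl => /ltW -> /ltW.
have := r1P 0 l h0 hl2 (ltac:(by rewrite subrr normr0)) lr1; rewrite lt_min => /andP[v01 v02].
have := r2P d l hd hl2 (ltac:(by rewrite subrr normr0)) lr2; rewrite lt_min => /andP[v11 _].
have kC : C * (k / (4 * C)) = k / 4 by field; rewrite gt_eqF.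
have i0i : v i 0 l = v i0 0 l by apply: vg; rewrite /lset /= in_itv.
move=> x0 hx0.
apply: (slice_le C0 lam0 (H_lip i) (H_disc i) (vc i) (@v_ray i) hl (x1 := 0) (x2 := d)) => //.
- exact: ltW.
- move=> x hx.
  have xX : 0 <= x <= X by case/andP: hx => -> /le_trans; exact.
  have := H_lip i (v i0 0 l0 + b i * x + c * x ^+ 2) (v i0 0 l + b i * x + c * x ^+ 2)
    (b i + 2 * c * x) (b i + 2 * c * x) (2 * c) (2 * c) xX xX hl02 hl2.
  have -> : v i0 0 l0 + b i * x + c * x ^+ 2 - (v i0 0 l + b i * x + c * x ^+ 2)
     = v i0 0 l0 - v i0 0 l by ring.
  rewrite !subrr !normr0 !addr0 add0r => h1.
  have h2 : `|l0 - l| * (1 + `|b i + 2 * c * x| + `|2 * c|) <= k / (4 * C).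
    apply: (@le_trans _ _ (`|l0 - l| * P)); last by rewrite -ler_pdivlMr // ltW.
    rewrite ler_wpM2l // /P lerD2r lerD2l (le_trans (ler_normD _ _)) // lerD2l.
    rewrite normrM ler_wpM2l //.
    by case/andP: xX => xge0 xleX; rewrite ger0_norm.
  have h3 := ler_wpM2l (ltW C0) (lerD h2 (ltW v02)).
  move: (le_trans h1 h3) (HZ x hx); rewrite mulrDr kC ler_norml => /andP[_ h4] h5.
  by move: h4 h5 k0; lra.
- by rewrite i0i; lra.
- move: v01 v11; rewrite !ltr_norml /g => /andP[? ?] /andP[? ?]; lra.
Qed.

(* If [v] fell faster at the vertex, [l |-> c l + A exp (- B (l - l0))] would touch
   it from above in the interior, and the barriers extend this test function to
   the rays with slopes [b]. *)
Lemma vertex_growth (i0 : 'I_n) (l0 k e : R) (c d : 'I_n -> R) : 0 < l0 < K -> 0 < k ->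
  0 < e -> (forall i, 0 < d i) -> (forall i, d i <= X) ->
  (forall i (x : R), 0 <= x <= d i ->
     k <= H i x l0 (v i0 0 l0 + b i * x + c i * x ^+ 2) (b i + 2 * c i * x) (2 * c i)) ->
  (forall i, v i (d i) l0 < v i0 0 l0 + b i * d i + c i * d i ^+ 2) ->
  exists2 r : R, 0 < r & forall l : R, l0 < l < K -> l - l0 < r ->
    - (F l0 b + e) * (l - l0) <= v i0 0 l - v i0 0 l0.
Proof.
move=> hl0 k0 e0 d0 dX HZ vd.
have [vc vg] := v_cont.
have h0 : 0 <= (0 : R) <= X by rewrite lexx ltW.
have [l00 l0K] : 0 < l0 /\ l0 < K by case/andP: hl0.
have [r1 r10 r1P] : exists2 r : R, 0 < r & forall i (l : R), 0 < l < K -> `|l0 - l| < r ->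
    forall x : R, 0 <= x <= d i -> v i x l <= v i0 0 l + b i * x + c i * x ^+ 2.
  apply: (@common_radius R n (fun i r => forall l : R, 0 < l < K -> `|l0 - l| < r ->
    forall x : R, 0 <= x <= d i -> v i x l <= v i0 0 l + b i * x + c i * x ^+ 2)).
    by move=> i r r' rr' Pr l hl /lt_le_trans/(_ rr'); exact: Pr.
  by move=> i; exact: (ray_barrier hl0 (d0 i) (dX i) k0 (@HZ i) (vd i)).
have [dm dm0 dmP] : exists2 r : R, 0 < r & forall i, r <= d i.
  apply: (@common_radius R n (fun i r => r <= d i)); first by move=> i r r' /le_trans; exact.
  by move=> i; exists (d i).
exists (Num.min r1 (e / CF)); first by rewrite lt_min r10 divr_gt0.
move=> y /andP[l0y yK]; rewrite lt_min => /andP[yr1 yre].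
rewrite leNgt; apply/negP => fall.
(* [s] is the claimed minimal growth rate; after removing it, [f] drops by [g] between [l0] and
   [y]. *)
pose s := - (F l0 b + e).
pose f m := v i0 0 m - s * m.
pose g := f l0 - f y.
have g0 : 0 < g by move: fall; rewrite /g /f -/s; lra.
have hl02 : 0 <= l0 <= K by case/andP: hl0 => /ltW -> /ltW.
have m0 : 0 < g / 4 by rewrite divr_gt0.
have [d1 d10 d1P] := cont_xl_dist (vc i0) h0 hl02 m0.
have sb0 : 0 < g / 4 / (1 + `|s|) by rewrite !divr_gt0 // ltr_pwDl.
have e10 : 0 < Num.min d1 (g / 4 / (1 + `|s|)) by rewrite lt_min d10.
have [A [B [x [A0 B0 [/andP[l0x xy]]]]]] := exp_barrier l0y g0 e10.
rewrite lt_min => /andP[xd1 xs] gA Ag.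
pose psi m := s * m + A * expR (- (B * (m - l0))).
pose psi' m := s - A * B * expR (- (B * (m - l0))).
have fx : f y + g / 2 <= f x.
  have x0l : `|l0 - x| < d1 by rewrite distrC gtr0_norm ?subr_gt0.
  have hx : 0 <= x <= K by rewrite (ltW (lt_trans l00 l0x)) (ltW (lt_trans xy yK)).
  have := d1P 0 x h0 hx (ltac:(by rewrite subrr normr0)) x0l.
  rewrite ltr_norml => /andP[_ h1].
  have : `|s * (x - l0)| <= g / 4.
    rewrite normrM (@gtr0_norm _ (x - l0)) ?subr_gt0 //.
    move: xs; rewrite ltr_pdivlMr ?ltr_pwDl // => xs.
    by rewrite mulrC (le_trans _ (ltW xs)) // ler_wpM2l ?lerDr // subr_ge0 ltW.
  rewrite ler_norml => /andP[_ h2].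
  by rewrite /g /f in h1 h2 *; lra.
have psiP (m : R) : is_derive m 1 psi (psi' m).
  by apply: is_derive_eq; rewrite /psi' /GRing.scale /=; ring.
have psi_cont (p : R) : {for p, continuous psi}.
  apply: differentiable_continuous; apply/derivable1_diffP.
  by have [] := psiP p.
have exp_cont : continuous (fun m : R => expR (- (B * (m - l0)))).
  move=> m; apply: (continuous_comp (f := fun m : R => - (B * (m - l0)))); last exact: continuous_expR.
  apply: cvgN; apply: cvgM; [exact: cvg_cst|].
  by apply: cvgB; [exact: cvg_id|exact: cvg_cst].
have psi'_cont : continuous psi'.
  move=> m; apply: cvgB; first exact: cvg_cst.
  by apply: cvgM; [exact: cvg_cst|exact: exp_cont].
have psi2_cont : continuous (fun p : R * R => psi p.2).
  by move=> p; apply: (continuous_comp (f := snd)); [exact: cvg_snd|exact: psi_cont].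
have [xm [lh [hxm hlh maxM]]] := cont_xl_max (vc i0) psi2_cont (lexx 0) (lexx 0) (ltW X0)
  (ltW l00) (ltW l0y) (ltW yK).
have xm0 : xm = 0 by apply/eqP; rewrite eq_le andbC.
rewrite {xm hxm}xm0 /= in maxM.
have {}maxM m : l0 <= m <= y -> v i0 0 m - psi m <= v i0 0 lh - psi lh.
  by move=> hm; apply: maxM => //; rewrite lexx.
(* The point [x] already beats [f y], whereas the penalised value is below [f y] at [l0], because
   [A > g], and at [y], because the penalty is positive. So [lh] is interior. *)
have top : f y < v i0 0 lh - psi lh.
  have := maxM x; rewrite (ltW l0x) (ltW xy) => /(_ isT).
  by move: fx Ag; rewrite /f /psi; lra.
have l0h : l0 < lh.
  case/andP: hlh => h1 _; rewrite lt_neqAle h1 andbT; apply/eqP => E.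
  move: top gA; rewrite -E /psi subrr mulr0 oppr0 expR0 /g /f; lra.
have lhy : lh < y.
  case/andP: hlh => _ h1; rewrite lt_neqAle h1 andbT; apply/eqP => E.
  have := mulr_gt0 A0 (expR_gt0 (- (B * (y - l0)))).
  by move: top; rewrite E /psi /f; lra.
have hlhK : 0 < lh < K by rewrite (lt_trans l00 l0h) (lt_trans lhy yK).
(* By the barriers, moving along a ray cannot exceed the value on the vertex line, so [lh] is a
   local maximum on the network. The decay of the exponential makes [psi' lh] less than [s], while
   [F lh b] is at most [- s]. *)
have : 0 <= psi' lh + F lh b.
  apply: (v_vertex (c := c) psiP psi'_cont hlhK (i := i0)).
  exists (Num.min dm (Num.min (lh - l0) (y - lh))); first by rewrite !lt_min dm0 !subr_gt0 l0h lhy.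
  move=> j x' m /andP[x'0 _] hm; rewrite !lt_min => /andP[x'd _] /andP[_ /andP[h1 h2]].
  have [h3 h4] : l0 < m /\ m < y.
    by move: h1 h2; rewrite !ltr_norml => /andP[? ?] /andP[? ?]; split; lra.
  have mK : 0 < m < K by rewrite (lt_trans l00 h3) (lt_trans h4 yK).
  have mr : `|l0 - m| < r1.
    rewrite distrC gtr0_norm ?subr_gt0 //; apply: lt_trans yr1.
    by rewrite ltrD2r.
  have := r1P j m mK mr x'; rewrite x'0 (le_trans (ltW x'd) (dmP j)) => /(_ isT) h5.
  have := maxM m; rewrite (ltW h3) (ltW h4) => /(_ isT) h6.
  by move: h5 h6; lra.
have : F lh b <= F l0 b + e.
  have hlh2 : 0 <= lh <= K by case/andP: hlhK => /ltW -> /ltW.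
  have := F_lip hlh2 hl02; rewrite (@gtr0_norm _ (lh - l0)) ?subr_gt0 // => h1.
  have h2 : CF * (lh - l0) <= e.
    rewrite mulrC -ler_pdivlMr // ltW //; apply: lt_trans yre.
    by rewrite ltrD2r.
  move: (le_trans h1 h2); rewrite ler_norml => /andP[_ h3]; lra.
have := mulr_gt0 (mulr_gt0 A0 B0) (expR_gt0 (- (B * (lh - l0)))).
by rewrite /psi' /s; lra.
Qed.

End Growth.
End Vertex.

(** * Comparison on the network *)

Section NetworkComparison.
Context {R : realType} {n : nat} (D : system R n).
Let X := ray_length D.
Let K := horizon D.
Hypotheses (hD : continuous_data D) (hE : elliptic D) (hR : lipschitz_data D).
Variables v u : 'I_n -> R -> R -> R.
Hypotheses (hv : subsolution D v) (hu : supersolution D u).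
Hypotheses (hbd : forall (i : 'I_n) (l : R), 0 <= l <= K -> v i X l <= u i X l)
  (hK : forall (i : 'I_n) (x : R), 0 <= x <= X -> v i x K <= u i x K).

Let X0 : 0 < X. Proof. exact: ray_length_gt0 hD. Qed.
Let K0 : 0 < K. Proof. exact: horizon_gt0 hD. Qed.
Let lam0 : 0 < discount D. Proof. exact: discount_gt0 hD. Qed.

Let v_cont i : cont_xl D (v i). Proof. by have [[+ _] _] := hv; exact. Qed.
Let u_cont i : cont_xl D (u i). Proof. by have [[+ _] _] := hu; exact. Qed.

Let vu_cont i : cont_xl D (fun x l => v i x l - u i x l).
Proof. by move=> p; apply: continuousB => ?; [exact: v_cont|exact: u_cont]. Qed.

Let v_glued i j l : 0 <= l <= K -> v i 0 l = v j 0 l.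
Proof. by move=> hl; have [[_ +] _] := hv; apply; rewrite /lset /= in_itv. Qed.
Let u_glued i j l : 0 <= l <= K -> u i 0 l = u j 0 l.
Proof. by move=> hl; have [[_ +] _] := hu; apply; rewrite /lset /= in_itv. Qed.

Lemma ray_comparison_lt (i : 'I_n) (l M : R) : 0 < l < K -> 0 < M ->
  (forall x : R, 0 <= x <= X -> v i x l - u i x l <= M) ->
  forall x : R, 0 < x < X -> v i x l - u i x l < M.
Proof.
have [C C0 hC] := ham_lipschitz_data hD hR.
have [s s0 hs] := ham_ellipticP hD hR hE.
have [Hlip Hbnd] := hC i.
exact: (ray_strict_max C0 s0 Hlip (hs i) (@ham_discountedP _ _ D i) Hbnd lam0
  (@u_cont i) (@v_cont i) (subsolution_ray_sub X0 K0 hv) (supersolution_ray_sub X0 K0 hu)).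
Qed.

(** A maximum above [M] could be neither at the vertex nor at the outer end, where [v - u <= 0]; the
    strict inequality excludes the interior. *)
Lemma ray_comparison (i : 'I_n) (l M : R) : 0 < l < K -> 0 < M ->
  v i 0 l - u i 0 l <= M -> forall x : R, 0 <= x <= X -> v i x l - u i x l <= M.
Proof.
move=> hl M0 vu0 x hx.
have [l0 lK] : 0 <= l /\ l <= K by case/andP: hl => /ltW ? /ltW.
have cf : continuous (fun _ : R * R => 0 : R) by move=> ?; exact: cvg_cst.
have [xm [lm [hxm]]] := cont_xl_max (@vu_cont i) cf (lexx 0) (ltW X0) (lexx X) l0 (lexx l) lK.
rewrite -eq_le => /eqP <- {lm} maxM.
have {}maxM y : 0 <= y <= X -> v i y l - u i y l <= v i xm l - u i xm l.
  by move=> hy; have := maxM y l hy; rewrite lexx !subr0 => /(_ isT).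
apply: le_trans (maxM x hx) _; rewrite leNgt; apply/negP => Mm.
have h1 : 0 < xm.
  by case/andP: hxm => h _; rewrite lt_neqAle h andbT; apply/eqP => E; move: Mm; rewrite -E; lra.
have h2 : xm < X.
  case/andP: hxm => _ h; rewrite lt_neqAle h andbT; apply/eqP => E.
  have := @hbd i l; rewrite l0 lK => /(_ isT); move: Mm; rewrite E; lra.
have := ray_comparison_lt hl (lt_trans M0 Mm) maxM (x := xm).
by rewrite h1 h2 ltxx => /(_ isT).
Qed.

(** At distance [d] the gap [v - u] is strictly below its vertex value [w0], so an end value fits
    strictly between [v] and [u + w0]. Level [discount D * w0 / 2] leaves a margin in the equation
    on both sides. *)
Lemma separating_quadratic (i0 i : 'I_n) (l0 : R) : 0 < l0 < K ->
  0 < v i0 0 l0 - u i0 0 l0 ->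
  exists d b c : R, [/\ 0 < d, d <= X,
    forall x : R, 0 <= x <= d ->
      discount D * (v i0 0 l0 - u i0 0 l0) / 8
        <= ham D i x l0 (v i0 0 l0 + b * x + c * x ^+ 2) (b + 2 * c * x) (2 * c)
        < discount D * (v i0 0 l0 - u i0 0 l0) / 2,
    v i d l0 < v i0 0 l0 + b * d + c * d ^+ 2 &
    v i0 0 l0 + b * d + c * d ^+ 2 - (v i0 0 l0 - u i0 0 l0) < u i d l0].
Proof.
move=> hl0; set w0 := v i0 0 l0 - u i0 0 l0 => w00.
have hl02 : 0 <= l0 <= K by case/andP: hl0 => /ltW -> /ltW.
have h0 : 0 <= (0 : R) <= X by rewrite lexx ltW.
have [C C0 hC] := ham_lipschitz_data hD hR.
have [s s0 hs] := ham_ellipticP hD hR hE.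
have [Hlip Hbnd] := hC i.
have e0 : 0 < discount D * w0 / 2 by rewrite divr_gt0 // mulr_gt0.
have vg := v_glued i i0 hl02.
have vi0 : v i 0 l0 - u i 0 l0 = w0 by rewrite vg (u_glued i i0 hl02).
have [eta eta0 etaP] :=
  quadratic_solution C0 s0 Hlip (hs i) Hbnd hl02 (normr_ge0 (v i0 0 l0)) e0.
have eta40 : 0 < eta / 4 by rewrite divr_gt0.
have [r r0 rP] := cont_xl_dist (@v_cont i) h0 hl02 eta40.
pose d := Num.min (Num.min (r / 2) X) (eta / 4).
have d0 : 0 < d by rewrite !lt_min X0 eta40 divr_gt0.
have dX : d <= X by rewrite !ge_min lexx orbT.
have deta : d <= eta / 4 by rewrite ge_min lexx orbT.
have dr : d < r.
  apply: (@le_lt_trans _ _ (r / 2)); first by rewrite !ge_min lexx.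
  by rewrite ltr_pdivrMr // ltr_pMr // ltr1n.
have hd : 0 <= d <= X by rewrite ltW.
have vd : `|v i0 0 l0 - v i d l0| < eta / 4.
  rewrite -vg; apply: rP => //; last by rewrite subrr normr0.
  by rewrite sub0r normrN gtr0_norm.
(* For [d < X] this is strictness inside the ray, for [d = X] the boundary inequality. *)
have gap : v i d l0 - u i d l0 < w0.
  have vu0 : v i 0 l0 - u i 0 l0 <= w0 by rewrite vi0.
  have [dltX|Xd] := ltP d X.
    apply: (ray_comparison_lt hl0 w00 (ray_comparison hl0 w00 vu0)).
    by rewrite d0.
  have -> : d = X by apply/eqP; rewrite eq_le dX.
  by apply: le_lt_trans w00; rewrite subr_le0 hbd.
have g0 : 0 < w0 - (v i d l0 - u i d l0) by rewrite subr_gt0.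
have [t t0 [tg teta]] : exists2 t : R, 0 < t &
    t < w0 - (v i d l0 - u i d l0) /\ t <= eta / 4.
  exists (Num.min ((w0 - (v i d l0 - u i d l0)) / 2) (eta / 4)).
    by rewrite lt_min eta40 divr_gt0.
  split; last by rewrite ge_min lexx orbT.
  apply: (@le_lt_trans _ _ ((w0 - (v i d l0 - u i d l0)) / 2)).
    by rewrite ge_min lexx.
  by rewrite ltr_pdivrMr // ltr_pMr // ltr1n.
have [p pdE] : exists p, p * d = v i d l0 + t - v i0 0 l0.
  by exists ((v i d l0 + t - v i0 0 l0) / d); rewrite divfK // gt_eqF.
have pd : d + `|p| * d <= eta.
  have -> : `|p| * d = `|t - (v i0 0 l0 - v i d l0)|.
    by rewrite -{1}(gtr0_norm d0) -normrM pdE; congr `|_|; ring.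
  have := ler_normB t (v i0 0 l0 - v i d l0); rewrite (gtr0_norm t0).
  by lra.
have d0X : 0 + d <= X by rewrite add0r.
have [z [b [c [Z1 Z2 HZ]]]] := etaP 0 d (v i0 0 l0) p (lexx 0) d0 d0X (lexx _) pd.
rewrite add0r in Z2 HZ.
have zE : z = v i0 0 l0 by move: Z1; rewrite mulr0 expr0n /= mulr0 !addr0.
rewrite {}zE in Z1 Z2 HZ; exists d, b, c; split => //.
- move=> x /HZ; have -> : discount D * w0 / 8 = discount D * w0 / 2 / 4 by field.
  by [].
- by rewrite Z2 pdE; lra.
- by rewrite Z2 pdE; lra.
Qed.

(** [vertex_growth] is applied to [v] with slopes [b] and to [- u] with slopes [- b]. The vertex
    terms are opposite and cancel in the sum, leaving the two errors [e / 2]. *)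
Lemma vertex_gap_growth (i0 : 'I_n) (l0 e : R) : 0 < l0 < K ->
  0 < v i0 0 l0 - u i0 0 l0 -> 0 < e ->
  exists2 r : R, 0 < r & forall l : R, l0 < l < K -> l - l0 < r ->
    v i0 0 l0 - u i0 0 l0 - e * (l - l0) <= v i0 0 l - u i0 0 l.
Proof.
move=> hl0 w00 e0.
have /choice [f fP] : forall i, exists t : R * R * R, [/\ 0 < t.1.1, t.1.1 <= X,
    forall x : R, 0 <= x <= t.1.1 ->
      discount D * (v i0 0 l0 - u i0 0 l0) / 8
        <= ham D i x l0 (v i0 0 l0 + t.1.2 * x + t.2 * x ^+ 2) (t.1.2 + 2 * t.2 * x) (2 * t.2)
        < discount D * (v i0 0 l0 - u i0 0 l0) / 2,
    v i t.1.1 l0 < v i0 0 l0 + t.1.2 * t.1.1 + t.2 * t.1.1 ^+ 2 &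
    v i0 0 l0 + t.1.2 * t.1.1 + t.2 * t.1.1 ^+ 2 - (v i0 0 l0 - u i0 0 l0) < u i t.1.1 l0].
  by move=> i; have [d [b [c H]]] := separating_quadratic i hl0 w00; exists (d, b, c).
pose d i := (f i).1.1; pose b i := (f i).1.2; pose c i := (f i).2.
have [C C0 hC] := ham_lipschitz_data hD hR.
have Hlip i := (hC i).1.
have [CF CF0 CFP] := vertex_ham_lipschitz hD hR b.
have e20 : 0 < e / 2 by rewrite divr_gt0.
have k0 : 0 < discount D * (v i0 0 l0 - u i0 0 l0) / 8 by rewrite divr_gt0 // mulr_gt0.
have [r1 r10 r1P] : exists2 r : R, 0 < r & forall l : R, l0 < l < K -> l - l0 < r ->
    - (vertex_ham D l0 b + e / 2) * (l - l0) <= v i0 0 l - v i0 0 l0.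
  apply: (vertex_growth (H := ham D) (c := c) (d := d) C0 Hlip (@ham_discountedP _ _ D)
    lam0 X0 CF0 CFP (proj1 hv) _ (subsolution_vertex_sub X0 K0 hv) hl0 k0 e20).
  - by move=> i; exact: subsolution_ray_sub.
  - by move=> i; have [] := fP i.
  - by move=> i; have [] := fP i.
  - by move=> i x hx; have [_ _ + _ _] := fP i => /(_ x hx)/andP[].
  - by move=> i; have [] := fP i.
pose F l (s : 'I_n -> R) := - vertex_ham D l (fun j => - s j).
have bNN : (fun j => - - b j) = b by apply/funext => j; rewrite opprK.
have FP l m : 0 <= l <= K -> 0 <= m <= K ->
    `|F l (fun j => - b j) - F m (fun j => - b j)| <= CF * `|l - m|.
  by move=> hl hm; rewrite /F bNN -opprD normrN; exact: CFP.
have nu_cont : network_continuous D (fun i x l => - u i x l).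
  split; first by move=> i; exact: cont_xlN.
  by move=> i j l hl; congr (- _); have [[_ +] _] := hu; apply.
have [r2 r20 r2P] : exists2 r : R, 0 < r & forall l : R, l0 < l < K -> l - l0 < r ->
    - (F l0 (fun j => - b j) + e / 2) * (l - l0) <= - u i0 0 l - - u i0 0 l0.
  apply: (vertex_growth (H := fun i => opp_ham (ham D i)) (c := fun j => - c j) (d := d)
    (v := fun i x l => - u i x l) C0
    _ _ lam0 X0 CF0 FP nu_cont _ (supersolution_vertex_sub X0 K0 hu) hl0 k0 e20).
  - by move=> i; exact: opp_ham_lipschitz.
  - by move=> i; apply: opp_ham_discounted; exact: ham_discountedP.
  - by move=> i; exact: supersolution_ray_sub.
  - by move=> i; have [] := fP i.
  - by move=> i; have [] := fP i.
  - move=> i x hx; have [_ _ + _ _] := fP i => /(_ x hx)/andP[_].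
    rewrite -/(b i) -/(c i) /opp_ham.
    have -> : - (2 * - c i) = 2 * c i by ring.
    have -> : - (- b i + 2 * - c i * x) = b i + 2 * c i * x by ring.
    have := @ham_discountedP _ _ D i x l0 (- (- u i0 0 l0 + - b i * x + - c i * x ^+ 2))
      (v i0 0 l0 + b i * x + c i * x ^+ 2) (b i + 2 * c i * x) (2 * c i).
    have -> : - (- u i0 0 l0 + - b i * x + - c i * x ^+ 2)
      - (v i0 0 l0 + b i * x + c i * x ^+ 2) = - (v i0 0 l0 - u i0 0 l0) by ring.
    by lra.
  - move=> i; have [_ _ _ _] := fP i; rewrite -/(b i) -/(c i) -/(d i); lra.
exists (Num.min r1 r2); first by rewrite lt_min r10.
move=> l hl; rewrite lt_min => /andP[/(r1P l hl) h1 /(r2P l hl)].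
by rewrite /F bNN; lra.
Qed.

(** Maximise [w m + g * m] over [[l, K]]. After a maximum, [w] must fall at rate at least [g],
    against the admissible rate [g / 2]. *)
Lemma vertex_comparison (i : 'I_n) (l : R) : 0 < l < K -> v i 0 l <= u i 0 l.
Proof.
move=> hl; rewrite leNgt; apply/negP => uv.
have [l0 lK] : 0 < l /\ l < K by case/andP: hl.
pose w m := v i 0 m - u i 0 m.
have w0 : 0 < w l by rewrite subr_gt0.
(* The tilt varies by at most [w l / 2] over the horizon, so [w] stays positive at the maximum,
   which thus differs from [K]. *)
pose g := w l / (2 * K).
have g0 : 0 < g by rewrite divr_gt0 // mulr_gt0.
have gK : g * K = w l / 2 by rewrite /g; field; rewrite gt_eqF.
have cf : continuous (fun p : R * R => - (g * p.2)).
  by move=> p; apply: cvgN; apply: cvgM; [exact: cvg_cst|exact: cvg_snd].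
have [xm [lm [hxm hlm maxM]]] := cont_xl_max (@vu_cont i) cf (lexx 0) (lexx 0) (ltW X0)
  (ltW l0) (ltW lK) (lexx K).
have xm0 : xm = 0 by apply/eqP; rewrite eq_le andbC.
rewrite {xm hxm}xm0 /= in maxM.
have {}maxM m : l <= m <= K -> w m + g * m <= w lm + g * lm.
  by move=> hm; have := maxM 0 m; rewrite lexx hm !opprK => /(_ isT isT).
have [llm lmK] : l <= lm /\ lm <= K by case/andP: hlm.
have top := maxM l; rewrite lexx (ltW lK) in top; have {}top := top isT.
have glm : g * lm <= g * K by rewrite ler_pM2l.
have gl : 0 < g * l by rewrite mulr_gt0.
have wlm : 0 < w lm by lra.
have lm0 : 0 < lm < K.
  rewrite (lt_le_trans l0 llm) lt_neqAle lmK andbT; apply/eqP => E.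
  by have := @hK i 0; rewrite lexx ltW // => /(_ isT); move: wlm; rewrite /w E; lra.
have g20 : 0 < g / 2 by rewrite divr_gt0.
have [r r0 rP] := vertex_gap_growth lm0 wlm g20.
pose t := Num.min (r / 2) ((K - lm) / 2).
have t0 : 0 < t by rewrite lt_min !divr_gt0 // subr_gt0; case/andP: lm0.
have tr : t < r.
  by apply: (@le_lt_trans _ _ (r / 2)); rewrite ?ge_min ?lexx // ltr_pdivrMr // ltr_pMr // ltr1n.
have tK : lm + t < K.
  rewrite -ltrBrDl; apply: (@le_lt_trans _ _ ((K - lm) / 2)).
    by rewrite ge_min lexx orbT.
  by rewrite ltr_pdivrMr // ltr_pMr ?ltr1n // subr_gt0; case/andP: lm0.
have := rP (lm + t); rewrite ltrDl t0 tK addrAC subrr add0r tr => /(_ isT isT) h1.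
have := maxM (lm + t); rewrite (ltW tK) (le_trans llm) ?lerDl ?(ltW t0) // => /(_ isT).
have : 0 < g * t by rewrite mulr_gt0.
by move: h1; rewrite /w; lra.
Qed.

Lemma interior_comparison (i : 'I_n) (x l : R) : 0 <= x <= X -> 0 < l < K ->
  v i x l <= u i x l.
Proof.
move=> hx hl; rewrite -subr_le0; apply/ler_addgt0Pr => e e0; rewrite add0r.
apply: (ray_comparison hl e0 _ hx).
by rewrite (le_trans _ (ltW e0)) // subr_le0 vertex_comparison.
Qed.

(** The equations hold only for [l > 0] and nothing is prescribed at [l = 0], so the inequality is
    obtained by continuity. *)
Lemma initial_comparison (i : 'I_n) (x : R) : 0 <= x <= X -> v i x 0 <= u i x 0.
Proof.
move=> hx; rewrite -subr_le0; apply/ler_addgt0Pr => e e0; rewrite add0r.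
have h0 : 0 <= (0 : R) <= K by rewrite lexx ltW.
have [d d0 dP] := cont_xl_dist (@vu_cont i) hx h0 e0.
pose t := Num.min (d / 2) (K / 2).
have t0 : 0 < t by rewrite lt_min !divr_gt0.
have td : t < d.
  by apply: (@le_lt_trans _ _ (d / 2)); rewrite ?ge_min ?lexx // ltr_pdivrMr // ltr_pMr // ltr1n.
have tK : t < K.
  by apply: (@le_lt_trans _ _ (K / 2)); rewrite ?ge_min ?lexx ?orbT // ltr_pdivrMr // ltr_pMr // ltr1n.
have ht : 0 < t < K by rewrite t0.
have := interior_comparison i hx ht.
have := dP x t hx; rewrite (ltW t0) (ltW tK) => /(_ isT).
rewrite subrr normr0 sub0r normrN gtr0_norm // => /(_ d0 td).
by rewrite ltr_norml => /andP[_]; lra.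
Qed.

End NetworkComparison.

Unset Implicit Arguments.

Theorem theorem2p2 (R : realType) (n : nat) (hn : (0 < n)%N)
  (D : system R n)
  (hD : continuous_data D)
  (hS : spin_bounded_below D)
  (hE : elliptic D)
  (hR : lipschitz_data D)
  (v u : 'I_n -> R -> R -> R)
  (hv : subsolution D v)
  (hu : supersolution D u)
  (hbd : forall (i : 'I_n) (l : R), 0 <= l <= horizon D ->
     v i (ray_length D) l <= u i (ray_length D) l)
  (hK : forall (i : 'I_n) (x : R), 0 <= x <= ray_length D ->
     v i x (horizon D) <= u i x (horizon D)) :
  forall (x : R) (i : 'I_n) (l : R),
    0 <= x <= ray_length D -> 0 <= l <= horizon D -> v i x l <= u i x l.
Proof.
move=> x i l hx /andP[l0 lK].
have [->|lK'] := eqVneq l (horizon D); first exact: hK.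
have [->|l0'] := eqVneq l 0; first exact: (initial_comparison hD hE hR hv hu hbd hK).
apply: (interior_comparison hD hE hR hv hu hbd hK i hx).
by rewrite !lt_neqAle l0 lK lK' eq_sym l0'.
Qed.
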